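(* Let $V_1,V_2:\mathbb{R}\to\mathbb{R}$ be measurable functions such that: (C1) $V_1$ is bounded from below, symmetric ($V_1(x)=V_1(-x)$ for all $x$), $\lim_{|x|\to\infty}V_1(x)=+\infty$, and $\int_\mathbb{R} e^{-2V_1(x)}\,dx<\infty$; (C2) $V_2$ is bounded from below, $\sup_{|x|\le\gamma}V_2(x)<\infty$ for some $\gamma>0$, and $\int_\mathbb{R}|x|\,e^{-V_2(x)}\,dx<\infty$. For $N\in\mathbb{N}$ and $\varepsilon\ge 0$ define the partition function $$\mathcal{Z}_{\varepsilon,N}=\int_{\mathbb{R}^{N-1}} e^{-\mathcal{H}_{[-1,N+1]}(\varphi)}\prod_{i=1}^{N-1}\big(\varepsilon\,\delta_0(d\varphi_i)+d\varphi_i\big),$$ where $\mathcal{H}_{[-1,N+1]}(\varphi)=\sum_{i=1}^{N+1}V_1(\nabla\varphi_i)+\sum_{i=0}^{N}V_2(\Delta\varphi_i)$, $\nabla\varphi_i=\varphi_i-\varphi_{i-1}$, $\Delta\varphi_i=\varphi_{i+1}+\varphi_{i-1}-2\varphi_i$, with boundary conditions $\varphi_{-1}=\varphi_0=\varphi_N=\varphi_{N+1}=0$, $\delta_0$ the Dirac mass at $0$ and $d\varphi_i$ Lebesgue measure. Let $F(\varepsilon)=\lim_{N\to\infty}\frac1N\log\big(\mathcal{Z}_{\varepsilon,N}/\mathcal{Z}_{0,N}\big)$ (this limit exists). Then $F(\varepsilon)>0$ for every $\varepsilon>0$; equivalently, the critical value $\varepsilon_c:=\sup\{\varepsilon\ge0: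 F(\varepsilon)=0\}$ equals $0$.
   Context: $F$ is the free energy of the pinning model $\mathbb{P}_{\varepsilon,N}(d\varphi_1,\dots,d\varphi_{N-1})=\mathcal{Z}_{\varepsilon,N}^{-1}e^{-\mathcal{H}_{[-1,N+1]}(\varphi)}\prod_{i=1}^{N-1}(\varepsilon\delta_0(d\varphi_i)+d\varphi_i)$; $F$ is non-decreasing in $\varepsilon$ with $F(0)=0$. *)

(* Defs.v *)
From HB Require Import structures.
From mathcomp Require Import all_boot all_order all_algebra.
From mathcomp Require Import all_classical all_reals all_analysis.
Set Implicit Arguments. Unset Strict Implicit. Unset Printing Implicit Defensive.
Import Order.TTheory GRing.Theory Num.Theory.
Import numFieldNormedType.Exports.
Local Open Scope ring_scope.

Section pinning.
Variable R : realType.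

Definition pin_measure (eps : {nonneg R}) :=
  measure_add (mscale eps (\d_(0 : measurableTypeR R))) (@lebesgue_measure R).

(* iterated integral over R^n of f : seq R -> \bar R (the seq has length n);
   for nonnegative integrands this is the integral w.r.t. the product measure *)
Fixpoint iter_int (mu : {measure set (measurableTypeR R) -> \bar R}) (n : nat)
    (f : seq R -> \bar R) : \bar R :=
  match n with
  | 0%N => f [::]
  | n'.+1 => (\int[mu]_x iter_int mu n' (fun s => f (x :: s)))%E
  end.

(* field phi_i for i : int, given the free coordinates s = (phi_1,...,phi_{N-1});
   boundary conditions phi_i = 0 for i <= 0 or i >= N *)
Definition field (N : nat) (s : seq R) (i : int) : R :=
  if (0 < i) && (i < N%:Z) then nth 0 s (`|i|%N.-1) else 0.

Definition hamiltonian (V1 V2 : R -> R) (N : nat) (s : seq R) : R :=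
  let phi := field N s in
  \sum_(1 <= i < N.+2) V1 (phi i%:Z - phi (i%:Z - 1))
  + \sum_(0 <= i < N.+1) V2 (phi (i%:Z + 1) + phi (i%:Z - 1) - 2 * phi i%:Z).

Definition partition (V1 V2 : R -> R) (eps : {nonneg R}) (N : nat) : \bar R :=
  iter_int (pin_measure eps) N.-1
    (fun s => (expR (- hamiltonian V1 V2 N s))%:E).

Definition free_energy_seq (V1 V2 : R -> R) (eps : {nonneg R}) (N : nat) : R :=
  ln (fine (partition V1 V2 eps N) / fine (partition V1 V2 0%:nng N)) / N%:R.

End pinning.

(* Main.v *)
(* Let lambda be the growth rate of the chain of increments, whose transfer
   operator is T f(x) = int exp(-V2(y - x)) exp(-V1(y)) f(y) dy, and let
   B_n(a, b) be the weight of the unpinned paths with initial heights a, b followed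
   by n free heights and two zeros. Since V1 tends to infinity, excursions of the
   increments outside a large interval have a much smaller weight than lambda, which
   gives T^n 1 <= C lambda^n, a matching lower bound, and T^n |x| <= lambda^n (|x| + C).
   Hence B_n(0, 0) <= C lambda^n, while the paths of length n with free starting height
   have mass of order lambda^n and typical height O(n). A path from zero to zero of
   length 2n is a pair of such paths with a common height b, because V1 is even and
   Delta is invariant under reversal; so B_2n(0, 0) is bounded below by the integral over
   b of a square, and Cauchy-Schwarz on |b| = O(n) gives B_N(0, 0) >= c lambda^N / N.
   A Steinhaus smoothing yields both parities of N.
   In particular the sum of B_N(0, 0) lambda^(-N) diverges. Pinning two consecutive
   heights decouples the path, so the pinned partition functions are superadditive and
   satisfy a renewal inequality with weights eps^2 B_k(0, 0); by divergence of the sum,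
   their growth rate exceeds lambda for every eps > 0. *)
Require Import Defs.
From HB Require Import structures.
From mathcomp Require Import all_boot all_order all_algebra.
From mathcomp Require Import all_classical all_reals all_analysis.
From mathcomp Require Import measurable_realfun.
From mathcomp Require Import ring lra zify.
Set Implicit Arguments. Unset Strict Implicit. Unset Printing Implicit Defensive.
Import Order.TTheory GRing.Theory Num.Theory.
Import numFieldNormedType.Exports.
Local Open Scope classical_set_scope.
Local Open Scope ring_scope.

(** * Nonnegative measurable functions *)

Section nonneg_measurable.
Context (R : realType).
Local Notation leb := (@lebesgue_measure R).
Local Notation RR := (measurableTypeR R).
Local Open Scope ereal_scope.

(** The difficulty is quantitative: the divergence of the sum of B_N(0, 0) lambda^(-N) would not
    survive an error of size e^(o(N)), so lambda has to be sharp up to constant factors. It is found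
    by trapping: paths confined to [-d, d] at both ends give a supermultiplicative sequence, paths
    with a free end a submultiplicative one, up to a shift and constants, and the two are comparable
    because the mass far away is small enough to be absorbed. Heights are controlled by their first
    moment, the moment that (C2) provides; the resulting window of width O(n) costs a factor 1/n in
    Cauchy-Schwarz, which the harmonic series just tolerates. V1 is merely measurable, so e^(-V1)
    has no positive lower bound on compact sets; bounds on its integrals over intervals replace it.
    The last inequality is strict because the rate of a superadditive sequence is a supremum: if the
    pinned rate were lambda, the pinned weights would be O(lambda^n) with no subexponential factor,
    and a bounded sequence cannot satisfy a renewal inequality with divergent weights. *)

Definition nnm d (T : measurableType d) (f : T -> \bar R) :=
  measurable_fun [set: T] f /\ forall x, 0 <= f x.

Lemma nnm_cst d (T : measurableType d) (c : R) : (0 <= c)%R ->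
  nnm (fun _ : T => c%:E).
Proof. by move=> c0; split => //= x; rewrite lee_fin. Qed.

Lemma nnm_comp d (T : measurableType d) d' (T' : measurableType d')
    (f : T -> \bar R) (g : T' -> T) : measurable_fun [set: T'] g -> nnm f ->
  nnm (fun x => f (g x)).
Proof. by move=> mg [mf f0]; split=> [|x]; [exact: measurableT_comp|]. Qed.

Lemma nnm_fst (f : RR -> \bar R) : nnm f -> nnm (fun p : RR * RR => f p.1).
Proof. by move=> nf; apply: (nnm_comp (g := @fst RR RR)). Qed.

Lemma nnm_snd (f : RR -> \bar R) : nnm f -> nnm (fun p : RR * RR => f p.2).
Proof. by move=> nf; apply: (nnm_comp (g := @snd RR RR)). Qed.

Lemma nnm_EFin d (T : measurableType d) (f : T -> R) :
  measurable_fun [set: T] f -> (forall x, 0 <= f x)%R ->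
  nnm (fun x => (f x)%:E).
Proof.
by move=> mf f0; split=> [|x]; [exact/measurable_EFinP|rewrite lee_fin].
Qed.

Lemma nnmM d (T : measurableType d) (f g : T -> \bar R) :
  nnm f -> nnm g -> nnm (fun x => f x * g x).
Proof.
by move=> [mf f0] [mg g0]; split=> [|x]; [exact: emeasurable_funM|exact: mule_ge0].
Qed.

Lemma nnmD d (T : measurableType d) (f g : T -> \bar R) :
  nnm f -> nnm g -> nnm (fun x => f x + g x).
Proof.
by move=> [mf f0] [mg g0]; split=> [|x]; [exact: emeasurable_funD|exact: adde_ge0].
Qed.

Lemma nnm_int d (T : measurableType d)
    (mu : {sigma_finite_measure set RR -> \bar R}) (f : T * RR -> \bar R) :
  nnm f -> nnm (fun x => \int[mu]_y f (x, y)).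
Proof.
move=> [mf f0]; split=> [|x]; last by apply: integral_ge0.
exact: measurable_fun_fubini_tonelli_F.
Qed.

Lemma int_le (mu : {measure set RR -> \bar R}) (f g : RR -> \bar R) : nnm f -> nnm g ->
  (forall x, f x <= g x) -> \int[mu]_x f x <= \int[mu]_x g x.
Proof. by move=> [mf f0] [mg g0] fg; exact: ge0_le_integral. Qed.

Lemma intD (mu : {measure set RR -> \bar R}) (f g : RR -> \bar R) : nnm f -> nnm g ->
  \int[mu]_x (f x + g x) = \int[mu]_x f x + \int[mu]_x g x.
Proof. by move=> [mf f0] [mg g0]; exact: ge0_integralD. Qed.

Lemma intZ (mu : {measure set RR -> \bar R}) (f : RR -> \bar R) (c : \bar R) : nnm f ->
  0 <= c -> \int[mu]_x (c * f x) = c * \int[mu]_x f x.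
Proof. by move=> [mf f0] c0; exact: ge0_integralZl. Qed.

Lemma intZr (mu : {measure set RR -> \bar R}) (f : RR -> \bar R) (c : \bar R) : nnm f ->
  0 <= c -> \int[mu]_x (f x * c) = (\int[mu]_x f x) * c.
Proof. by move=> [mf f0] c0; exact: ge0_integralZr. Qed.

Lemma int_swap (f : RR * RR -> \bar R) : nnm f ->
  \int[leb]_x \int[leb]_y f (x, y) = \int[leb]_y \int[leb]_x f (x, y).
Proof. by move=> [mf f0]; exact: (@fubini_tonelli _ _ _ _ R leb leb f mf f0).
Qed.

(** By uniqueness of the measure that gives every half-open interval its length. *)
Lemma lebesgue_measure_shift (c : R) (A : set R) : measurable A ->
  pushforward leb ((fun x => x + c)%R : _ -> RR) A = leb A.
Proof.
have ms : measurable_fun [set: RR] ((fun x => x + c)%R : RR -> RR).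
  by apply: measurable_funD => //; exact: measurable_cst.
move=> mA; apply/esym/lebesgue_measure_unique => //= _ [[a b]] _ <-.
rewrite /pushforward.
have -> : ((fun x => x + c)%R : RR -> RR) @^-1` [set` `]a, b]] = [set` `]a - c, b - c]]%R.
  by apply/seteqP; split => x /=; rewrite !in_itv/= ltrBlDr lerBrDr.
rewrite !lebesgue_measure_itv/= !lte_fin ltrD2r; case: ifPn => // _.
by rewrite -!EFinD; congr (_%:E); lra.
Qed.

Lemma int_shift (f : RR -> \bar R) (c : R) : nnm f ->
  \int[leb]_x f (x + c)%R = \int[leb]_x f x.
Proof.
move=> [mf f0].
have ms : measurable_fun [set: RR] ((fun x => x + c)%R : RR -> RR).
  by apply: measurable_funD => //; exact: measurable_cst.
transitivity (\int[pushforward leb ((fun x => x + c)%R : RR -> RR)]_x f x).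
  by rewrite ge0_integral_pushforward.
by apply: eq_measure_integral => A mA _; exact: lebesgue_measure_shift.
Qed.

End nonneg_measurable.

Lemma measurable_abs (R : realType) d (T : measurableType d) (f : T -> R) :
  measurable_fun [set: T] f -> measurable_fun [set: T] (fun x => `|f x|).
Proof. by move=> mf; exact: (measurableT_comp (@normr_measurable R _) mf). Qed.

Lemma measurable_fst_fst d1 d2 d3 (T1 : measurableType d1) (T2 : measurableType d2)
    (T3 : measurableType d3) :
  measurable_fun [set: (T1 * T2) * T3] (fun p => p.1.1).
Proof. exact: measurableT_comp. Qed.

Lemma measurable_fst_snd d1 d2 d3 (T1 : measurableType d1) (T2 : measurableType d2)
    (T3 : measurableType d3) :
  measurable_fun [set: (T1 * T2) * T3] (fun p => p.1.2).
Proof. exact: measurableT_comp. Qed.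

Ltac mreal := repeat first
  [ exact: measurable_cst | exact: measurable_fst | exact: measurable_snd
  | exact: measurable_fst_fst | exact: measurable_fst_snd
  | exact: measurable_id | exact: oppr_measurable | assumption
  | apply: measurable_funB | apply: measurable_funN | apply: measurable_funD
  | apply: measurable_funM
  | apply: measurable_abs | apply: measurable_fun_pair ].

(** * Indicators of intervals as real functions *)

Section indicators.
Context (R : realType).
Local Notation leb := (@lebesgue_measure R).
Local Notation RR := (measurableTypeR R).

Definition ind (a x : R) : R := (`|x| <= a)%R%:R.

Lemma ind_ge0 a x : 0 <= ind a x.
Proof. by rewrite /ind. Qed.

Lemma ind_le1 a x : ind a x <= 1.
Proof. by rewrite /ind lern1; case: (_ <= _). Qed.

Lemma measurable_bool d (T : measurableType d) (p : T -> bool) :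
  measurable_fun [set: T] p -> measurable_fun [set: T] (fun x => (p x)%:R : R).
Proof.
move=> mp.
have -> : (fun x => (p x)%:R : R) = (fun x => if p x then 1 else 0).
  by apply/funext => x; case: (p x).
by apply: measurable_fun_ifT => //; exact: measurable_cst.
Qed.

Lemma measurable_ind a : measurable_fun [set: RR] (ind a : RR -> R).
Proof.
by apply: measurable_bool; apply: measurable_fun_ler; mreal.
Qed.

Lemma measurable_itvb (a b : R) : measurable_fun [set: RR] (fun y : RR => (a <= y <= b)%R%:R : R).
Proof.
apply: measurable_bool; apply: measurable_and; apply: measurable_fun_ler;
  mreal.
Qed.

Lemma int_itvb (a b : R) : a <= b ->
  (\int[leb]_y ((a <= y <= b)%R%:R)%:E = (b - a)%:E)%E.
Proof.
move=> ab.
under eq_integral => y _.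
  have -> : ((a <= y <= b)%R%:R : R) = \1_[set` `[a, b]] y.
    by rewrite indicE mem_setE in_itv.
  over.
rewrite integral_indic//= setIT lebesgue_measure_itv/= lte_fin.
case: ltP => [_|ba]; first by rewrite -EFinB.
by rewrite (_ : b = a) ?subrr//; apply/eqP; rewrite eq_le ab ba.
Qed.

Lemma integral_ind (a : R) : 0 <= a ->
  (\int[leb]_y (ind a y)%:E = (2 * a)%:E)%E.
Proof.
move=> a0; have -> : 2 * a = a - - a by lra.
rewrite -int_itvb; last lra.
by apply: eq_integral => y _; rewrite /ind ler_norml.
Qed.

End indicators.

(** * Integrals of a positive measurable density over short intervals *)

Section density.
Context (R : realType) (e1 : R -> R).
Local Notation leb := (@lebesgue_measure R).
Local Notation RR := (measurableTypeR R).
Hypotheses (me : measurable_fun [set: RR] (e1 : RR -> R)) (e_gt0 : forall x, 0 < e1 x).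

Definition low (A k x : R) : R := ((`|x| <= A) && (e1 x < k))%R%:R.

Lemma measurable_low A k : measurable_fun [set: RR] (low A k : RR -> R).
Proof.
apply: measurable_bool; apply: measurable_and.
  by apply: measurable_fun_ler; mreal.
by apply: measurable_fun_ltr; mreal.
Qed.

(** The sets where [e1] is below [1 / n.+1] inside [[-A, A]] decrease to the empty set, since [e1]
    is positive everywhere, and have finite measure: continuity from above applies. *)
Lemma low_small A eta : 0 < eta ->
  exists2 k, 0 < k & (\int[leb]_x (low A k x)%:E <= eta%:E)%E.
Proof.
move=> eta0.
pose F n : set RR := [set x | (`|x| <= A) && (e1 x < n.+1%:R^-1)].
have FE n : (fun x => (low A n.+1%:R^-1 x)%:E) = (fun x => (\1_(F n) x)%:E).
  by apply/funext => x; rewrite indicE /low; congr ((nat_of_bool _)%:R%:E); apply/idP/idP; rewrite inE.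
have mF n : measurable (F n).
  have := measurable_and
     (measurable_fun_ler (measurable_abs (@measurable_id _ RR setT)) (@measurable_cst _ _ RR _ setT A))
     (measurable_fun_ltr me (@measurable_cst _ _ RR _ setT (n.+1%:R^-1:R))).
  move=> /(_ measurableT [set true] I); rewrite setTI => mm.
  by apply: (eq_ind _ measurable mm); apply/seteqP; split.
have finF : (leb (F 0%N) < +oo)%E.
  apply: (@le_lt_trans _ _ (leb [set` `[- A, A]])).
    apply: le_measure; rewrite ?inE//.
    by move=> x /=; rewrite in_itv/= -ler_norml => /andP[].
  by rewrite lebesgue_measure_itv/=; case: ifP => _; rewrite -?EFinD ltry.
have c0 : leb (F n) @[n --> \oo] --> 0%E.
  rewrite -(measure0 leb) -(_ : \bigcap_n F n = set0).
    apply: nonincreasing_cvg_mu => //; first exact: bigcap_measurable.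
    move=> m n mn; apply/subsetPset => x /andP[xA ex]; apply/andP; split => //.
    by apply: lt_le_trans ex _; rewrite lef_pV2 ?posrE// ler_nat ltnS.
  apply/seteqP; split => // x /= Fx.
  have [n] := ltr_add_invr (e_gt0 x).
  rewrite add0r => nx; have /andP[_] := Fx n I.
  by rewrite ltNge (ltW nx).
move/fine_cvgP : c0 => [[N1 _ fin] /cvgrPdist_lt /(_ _ eta0) [N2 _ small]].
exists (maxn N1 N2).+1%:R^-1; first by rewrite invr_gt0.
rewrite FE integral_indic// setIT.
have fi := fin (maxn N1 N2) (leq_maxl _ _).
have := small (maxn N1 N2) (leq_maxr _ _).
rewrite /= sub0r normrN => sm; rewrite -(fineK fi) lee_fin ltW//.
exact: le_lt_trans (ler_norm _) sm.
Qed.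

(** Substitute for a pointwise lower bound of [e1] on [[-A, A]]: below the threshold of [low_small]
    lies a set of measure at most [l / 2], so at least half of each interval of length [l] carries a
    density above it, uniformly in its position. *)
Lemma density_itv A l : 0 < l -> exists2 k, 0 < k &
  forall a b, - A <= a -> b <= A -> b - a = l ->
   (k%:E <= \int[leb]_y ((a <= y <= b)%R%:R * e1 y)%:E)%E.
Proof.
move=> l0; have l20 : 0 < l / 2 by lra.
have [k k0 ks] := low_small A l20.
exists (k * (l / 2)); first by nra.
move=> a b aA bA ba.
rewrite -(@leeD2rE _ (k * (l / 2))%:E)//.
have -> : ((k * (l / 2))%:E + (k * (l / 2))%:E = k%:E * (b - a)%:E)%E.
  by rewrite -EFinD -EFinM; congr (_%:E); rewrite ba; lra.
rewrite -int_itvb; last lra.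
rewrite -intZ; last 2 first.
- by apply: nnm_EFin => //; exact: measurable_itvb.
- by rewrite lee_fin ltW.
have n1 : nnm (fun y : RR => ((a <= y <= b)%R%:R * e1 y)%:E).
  apply: nnm_EFin => [|x]; last by rewrite mulr_ge0// ltW.
  apply: measurable_funM => //; exact: measurable_itvb.
have n2 : nnm (fun y : RR => (low A k y)%:E).
  by apply: nnm_EFin => //; exact: measurable_low.
apply: (@le_trans _ _ (\int[leb]_y (((a <= y <= b)%R%:R * e1 y)%:E + k%:E * (low A k y)%:E))%E).
  apply: int_le.
  - by apply: nnmM; [exact: nnm_cst (ltW k0)|apply: nnm_EFin => //; exact: measurable_itvb].
  - by apply: nnmD => //; apply: nnmM => //; exact: nnm_cst (ltW k0).
  - move=> y; rewrite -!EFinM -EFinD lee_fin /low.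
    have [/andP[ay yb]|_] := boolP (a <= y <= b); last first.
      by rewrite mulr0 mul0r add0r mulr_ge0// ltW.
    have -> : `|y| <= A by rewrite ler_norml; lra.
    by case: ltP => /=; have := e_gt0 y; lra.
rewrite intD//; last by apply: nnmM => //; exact: nnm_cst (ltW k0).
rewrite intZ//; last by rewrite lee_fin ltW.
by apply: leeD2l; rewrite EFinM lee_pmul2l.
Qed.

End density.

(** * The increment transfer operator *)

Section transfer.
Context (R : realType) (e1 : R -> R).
Local Notation leb := (@lebesgue_measure R).
Local Notation RR := (measurableTypeR R).
Hypotheses (me : measurable_fun [set: RR] (e1 : RR -> R)) (e_gt0 : forall x, 0 < e1 x).
Local Open Scope ereal_scope.

Definition transfer (h : R -> R) (f : R -> \bar R) (x : R) : \bar R :=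
  \int[leb]_y ((h (y - x) * e1 y)%:E * f y).

(** The weight [e1] is chosen so that the adjoint of [transfer h] is again a transfer operator, with
    [h] replaced by its reflection. *)
Definition dot (g f : R -> \bar R) : \bar R :=
  \int[leb]_x ((e1 x)%:E * (g x * f x)).

Lemma e_ge0 x : (0 <= e1 x)%R. Proof. exact: ltW. Qed.

Lemma measurable_subc (h : R -> R) c : measurable_fun [set: RR] (h : RR -> R) ->
  measurable_fun [set: RR] ((fun x => h (x - c)%R) : RR -> R).
Proof. by move=> mh; apply: (measurableT_comp mh); mreal. Qed.

Section kernel_facts.
Variable h : R -> R.
Hypotheses (mh : measurable_fun [set: RR] (h : RR -> R)) (h0 : forall x, (0 <= h x)%R).
Local Notation T := (transfer h).
Implicit Types f g : RR -> \bar R.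

Lemma nnm_kernel x : nnm ((fun y => (h (y - x) * e1 y)%:E) : RR -> \bar R).
Proof.
apply: nnm_EFin => [|y]; last by rewrite mulr_ge0// e_ge0.
by apply: measurable_funM => //; exact: measurable_subc.
Qed.

Lemma nnm_kernelM x f : nnm f -> nnm ((fun y => (h (y - x) * e1 y)%:E * f y) : RR -> \bar R).
Proof. by move=> nf; apply: nnmM => //; exact: nnm_kernel. Qed.

Lemma nnm_transfer f : nnm f -> nnm (T f : RR -> \bar R).
Proof.
move=> nf; apply: (@nnm_int _ _ _ leb (fun p : RR * RR => (h (p.2 - p.1) * e1 p.2)%:E * f p.2)).
apply: nnmM; last exact: nnm_snd.
apply: nnm_EFin => [|y]; last by rewrite mulr_ge0// e_ge0.
apply: measurable_funM; first by apply: (measurableT_comp mh); mreal.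
by apply: (measurableT_comp me); mreal.
Qed.

Lemma transfer_le f g x : nnm f -> nnm g -> (forall x, f x <= g x) -> T f x <= T g x.
Proof.
move=> nf ng fg; apply: int_le => [||y]; try exact: nnm_kernelM.
by rewrite lee_wpmul2l// lee_fin mulr_ge0// e_ge0.
Qed.

Lemma transferD f g x : nnm f -> nnm g -> T (fun y => f y + g y) x = T f x + T g x.
Proof.
move=> nf ng; rewrite /transfer -intD; try exact: nnm_kernelM.
apply: eq_integral => y _; rewrite ge0_muleDr//; [exact: nf.2|exact: ng.2].
Qed.

Lemma transferZ f (c : \bar R) x : nnm f -> 0 <= c -> T (fun y => c * f y) x = c * T f x.
Proof.
move=> nf c0; rewrite /transfer -intZ//; last exact: nnm_kernelM.
by apply: eq_integral => y _; rewrite muleCA.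
Qed.

Lemma nnm_iter n f : nnm f -> nnm (iter n T f : RR -> \bar R).
Proof. by move=> nf; elim: n => //= n; exact: nnm_transfer. Qed.

Lemma iter_le n f g x : nnm f -> nnm g -> (forall x, f x <= g x) ->
  iter n T f x <= iter n T g x.
Proof.
by move=> nf ng fg; elim: n x => //= n IH x; apply: transfer_le => //; exact: nnm_iter.
Qed.

Lemma iter_transferD n f g x : nnm f -> nnm g ->
  iter n T (fun y => f y + g y) x = iter n T f x + iter n T g x.
Proof.
move=> nf ng; elim: n x => //= n IH x.
rewrite -transferD; try exact: nnm_iter.
by congr (T _ x); apply/funext => y; exact: IH.
Qed.

Lemma iter_transferZ n f (c : \bar R) x : nnm f -> 0 <= c ->
  iter n T (fun y => c * f y) x = c * iter n T f x.
Proof.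
move=> nf c0; elim: n x => //= n IH x.
rewrite -transferZ//; last exact: nnm_iter.
by congr (T _ x); apply/funext => y; exact: IH.
Qed.

Lemma nnm_dot f g : nnm f -> nnm g -> nnm ((fun x => (e1 x)%:E * (g x * f x)) : RR -> \bar R).
Proof.
by move=> nf ng; apply: nnmM; [apply: nnm_EFin => //; exact: e_ge0|exact: nnmM].
Qed.

Lemma dot_le g f f' : nnm g -> nnm f -> nnm f' -> (forall x, f x <= f' x) ->
  dot g f <= dot g f'.
Proof.
move=> ng nf nf' ff'; apply: int_le => [||x]; try exact: nnm_dot.
rewrite lee_wpmul2l// ?lee_fin ?e_ge0//; rewrite lee_wpmul2l//; exact: ng.2.
Qed.

Lemma dotC g f : dot g f = dot f g.
Proof. by apply: eq_integral => x _; rewrite (muleC (g x)). Qed.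

Lemma dotD g f f' : nnm g -> nnm f -> nnm f' ->
  dot g (fun x => f x + f' x) = dot g f + dot g f'.
Proof.
move=> ng nf nf'; rewrite /dot -intD; try exact: nnm_dot.
apply: eq_integral => x _; rewrite ge0_muleDr; [|exact: nf.2|exact: nf'.2].
by rewrite ge0_muleDr// mule_ge0//; [exact: ng.2|exact: nf.2|exact: ng.2|exact: nf'.2].
Qed.

Lemma dotZ g f (c : \bar R) : nnm g -> nnm f -> 0 <= c ->
  dot g (fun x => c * f x) = c * dot g f.
Proof.
move=> ng nf c0; rewrite /dot -intZ//; last exact: nnm_dot.
by apply: eq_integral => x _; rewrite (muleCA (g x)) (muleCA (e1 x)%:E).
Qed.

Lemma dot_ge0 g f : nnm g -> nnm f -> 0 <= dot g f.
Proof. by move=> ng nf; apply: integral_ge0 => x _; apply: (nnm_dot nf ng).2. Qed.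

End kernel_facts.

Lemma dot_transfer (h : R -> R) (mh : measurable_fun [set: RR] (h : RR -> R))
    (h0 : forall x, (0 <= h x)%R) (f g : RR -> \bar R) : nnm f -> nnm g ->
  dot g (transfer h f) = dot f (transfer (fun u => h (- u)%R) g).
Proof.
move=> nf ng; rewrite /dot /transfer.
pose F (p : RR * RR) := (e1 p.1)%:E * g p.1 * ((h (p.2 - p.1) * e1 p.2)%:E * f p.2).
have nF : nnm F.
  apply: nnmM; apply: nnmM.
  - by apply: nnm_EFin => [|y]; [apply: (measurableT_comp me); mreal|exact: e_ge0].
  - exact: nnm_fst.
  - apply: nnm_EFin => [|y]; last by rewrite mulr_ge0// e_ge0.
    apply: measurable_funM; first by apply: (measurableT_comp mh); mreal.
    by apply: (measurableT_comp me); mreal.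
  - exact: nnm_snd.
transitivity (\int[leb]_x \int[leb]_y F (x, y)).
  apply: eq_integral => x _; rewrite muleA -intZ//; first exact: nnm_kernelM.
  by rewrite mule_ge0// ?lee_fin ?e_ge0//; exact: ng.2.
rewrite int_swap//; apply: eq_integral => y _.
have mh' : measurable_fun [set: RR] ((fun u => h (- u)%R) : RR -> R).
  by apply: (measurableT_comp mh); mreal.
rewrite muleA -intZ; last 2 first.
- exact: (@nnm_kernelM (fun u => h (- u)%R) mh').
- by rewrite mule_ge0// ?lee_fin ?e_ge0//; exact: nf.2.
apply: eq_integral => x _; rewrite /F /= opprB !EFinM.
rewrite -!(muleA (h _)%:E); move: (_ * g x) (_ * f y) (h _)%:E => a b c.
by rewrite muleCA [RHS]muleCA (muleC a).
Qed.

Lemma dot_iter (h : R -> R) (mh : measurable_fun [set: RR] (h : RR -> R))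
    (h0 : forall x, (0 <= h x)%R) n (f g : RR -> \bar R) : nnm f -> nnm g ->
  dot g (iter n (transfer h) f) = dot f (iter n (transfer (fun u => h (- u)%R)) g).
Proof.
move=> nf; elim: n g => [|n IH] g ng; first exact: dotC.
rewrite [in RHS]iterSr [iter _.+1 _ _]/= dot_transfer//; last exact: nnm_iter.
rewrite dotC IH//.
apply: nnm_transfer => //.
by apply: (measurableT_comp mh); mreal.
Qed.

Lemma transfer_ge_itv (h : R -> R) (d c0 : R) :
  measurable_fun [set: RR] (h : RR -> R) -> (forall x, (0 <= h x)%R) ->
  (0 <= c0)%R -> (forall x, `|x| <= 2 * d -> c0 <= h x)%R ->
  forall (f : RR -> \bar R) (a b c x : R), nnm f -> (0 <= c)%R ->
  (forall y, (a <= y <= b)%R -> (`|y - x| <= 2 * d)%R /\ c%:E <= f y) ->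
  (c0 * c)%:E * \int[leb]_y ((a <= y <= b)%R%:R * e1 y)%:E <= transfer h f x.
Proof.
move=> mh h0 c00 hc f a b c x nf c_ge0 H.
have n1 : nnm ((fun y => ((a <= y <= b)%R%:R * e1 y)%:E) : RR -> \bar R).
  apply: nnm_EFin => [|y]; last by rewrite mulr_ge0// e_ge0.
  by apply: measurable_funM => //; exact: measurable_itvb.
rewrite -intZ//; last by rewrite lee_fin mulr_ge0.
apply: int_le => [||y].
- by apply: nnmM => //; apply: nnm_cst; exact: mulr_ge0.
- exact: nnm_kernelM.
have [/H[yx cf]|_] := boolP (a <= y <= b)%R; last first.
  by rewrite mul0r mule0 mule_ge0// ?lee_fin ?mulr_ge0 ?e_ge0//; exact: nf.2.
rewrite mul1r (_ : (c0 * c)%:E * (e1 y)%:E = (c0 * e1 y)%:E * c%:E); last first.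
  by rewrite -!EFinM; congr (_%:E); ring.
by apply: lee_pmul; rewrite ?lee_fin ?mulr_ge0 ?e_ge0 ?ler_wpM2r ?hc ?e_ge0.
Qed.

Lemma nnm_ind d : nnm ((fun y => (ind d y)%:E) : RR -> \bar R).
Proof. by apply: nnm_EFin; [exact: measurable_ind|exact: ind_ge0]. Qed.

(* Walk towards [0] in steps of length between [d / 2] and [d]. *)
Lemma transfer_bridge (h : R -> R) (d c0 : R) :
  measurable_fun [set: RR] (h : RR -> R) -> (forall x, (0 <= h x)%R) ->
  (0 < d)%R -> (0 < c0)%R -> (forall x, `|x| <= 2 * d -> c0 <= h x)%R ->
  forall q, exists2 c : R, (0 < c)%R & forall x, (`|x| <= q.+2%:R * (d / 2))%R ->
    c%:E <= iter q.+1 (transfer h) (fun y => (ind d y)%:E) x.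
Proof.
move=> mh h0 d0 c00 hc; elim=> [|q [c c_gt0 IH]].
  have [k k0 hk] := density_itv me e_gt0 d (mulr_gt0 (ltr0n _ 2) d0).
  exists (c0 * k)%R; first exact: mulr_gt0.
  move=> x xd /=.
  apply: (le_trans _ (@transfer_ge_itv h d c0 mh h0 (ltW c00) hc _ (- d)%R d 1%R x _ _ _)) => //.
  - by rewrite mulr1 EFinM lee_pmul2l// hk// ; lra.
  - exact: nnm_ind.
  - move=> y ; rewrite -ler_norml => yd; split; last by rewrite /ind yd.
    by rewrite (le_trans (ler_normB _ _))//; lra.
have d20 : (0 < d / 2)%R by lra.
have [k k0 hk] := density_itv me e_gt0 (q.+3%:R * (d / 2)) d20.
exists (c0 * c * k)%R; first by rewrite !mulr_gt0.
have q0 : (0 <= q%:R * (d / 2))%R by rewrite mulr_ge0// ltW.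
have qE n : (n.+1%:R * (d / 2))%R = (n%:R * (d / 2) + d / 2)%R :> R by rewrite -addn1 natrD; ring.
move=> x xq.
have [x0|x0] := leP 0%R x.
- have := @transfer_ge_itv h d c0 mh h0 (ltW c00) hc _ (x - d)%R (x - d / 2)%R c x _ (ltW c_gt0).
  move=> /(_ _ (nnm_iter mh h0 q.+1 (nnm_ind d))) H.
  rewrite ger0_norm// !qE in xq.
  apply: (le_trans _ (H _)).
    by rewrite EFinM lee_pmul2l ?lte_fin ?mulr_gt0// hk// ?qE; lra.
  move=> y /andP[y1 y2]; split; first by rewrite ler_norml; lra.
  by apply: IH; rewrite ler_norml !qE; lra.
- have := @transfer_ge_itv h d c0 mh h0 (ltW c00) hc _ (x + d / 2)%R (x + d)%R c x _ (ltW c_gt0).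
  move=> /(_ _ (nnm_iter mh h0 q.+1 (nnm_ind d))) H.
  rewrite ltr0_norm// !qE in xq.
  apply: (le_trans _ (H _)).
    by rewrite EFinM lee_pmul2l ?lte_fin ?mulr_gt0// hk// ?qE; lra.
  move=> y /andP[y1 y2]; split; first by rewrite ler_norml; lra.
  by apply: IH; rewrite ler_norml !qE; lra.
Qed.

End transfer.

(** * Fekete's lemma *)

Section fekete.
Context (R : realType).

Lemma superadditive_iter (a : nat -> R) (n0 m r q : nat) :
  (forall n m, (n0 <= n)%N -> (n0 <= m)%N -> a n + a m <= a (n + m)%N) ->
  (n0 <= m)%N -> (n0 <= r)%N -> q%:R * a m + a r <= a (q * m + r)%N.
Proof.
move=> sa nm nr; elim: q => [|q IH]; first by rewrite mul0r add0r mul0n add0n.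
rewrite mulSn -addnA; apply: le_trans (sa _ _ nm (leq_trans nr (leq_addl _ _))).
by rewrite -addn1 natrD; lra.
Qed.

(** The threshold [n0] is there because the logarithms to which the lemma is applied are controlled
    only once the weights are known to be positive. The limit is the supremum of [a n / n], hence
    the bound without error term. *)
Lemma fekete (a : nat -> R) (n0 : nat) (C : R) : (0 < n0)%N ->
  (forall n m, (n0 <= n)%N -> (n0 <= m)%N -> a n + a m <= a (n + m)%N) ->
  (forall n, (n0 <= n)%N -> a n <= C * n%:R) ->
  exists2 l : R, a n / n%:R @[n --> \oo] --> l &
    forall n, (n0 <= n)%N -> a n <= l * n%:R.
Proof.
move=> n00 sa aC.
pose E : set R := [set a n / n%:R | n in [set n | (n0 <= n)%N]].
have supE : has_sup E.
  split; first by exists (a n0 / n0%:R), n0 => //=.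
  exists C => _ [n /= nn <-]; rewrite ler_pdivrMr ?aC// ltr0n.
  exact: leq_trans nn.
have ubE n : (n0 <= n)%N -> a n / n%:R <= sup E.
  by move=> nn; apply: sup_upper_bound => //; exists n.
exists (sup E); last first.
  by move=> n nn; rewrite -ler_pdivrMr ?ubE// ltr0n; exact: leq_trans nn.
apply/cvgrPdist_lt => e e0.
have e20 : 0 < e / 2 by lra.
have [_ [m /= nm <-] mE] := sup_adherent e20 supE.
have m0 : (0 < m)%N by exact: leq_trans nm.
have m0R : 0 < m%:R :> R by rewrite ltr0n.
pose c := \sum_(r < n0 + m) `|a r|.
have c_le r : (r < n0 + m)%N -> - c <= a r.
  move=> rm; rewrite lerNl (le_trans (ler_norm _))// normrN /c.
  by rewrite (bigD1 (Ordinal rm))//= lerDl sumr_ge0.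
pose K := (n0 + m)%:R * `|a m / m%:R| + c.
have c0 : 0 <= c by rewrite sumr_ge0.
have K0 : 0 <= K by rewrite addr_ge0// mulr_ge0.
have lower n : (n0 <= n)%N -> n%:R * (a m / m%:R) - K <= a n.
  (* The remainder is taken in [[n0, n0 + m)], so that superadditivity may be applied to it. *)
  move=> nn; pose q := ((n - n0) %/ m)%N; pose r := (n0 + (n - n0) %% m)%N.
  have nE : n = (q * m + r)%N by rewrite /q /r addnCA -divn_eq subnKC.
  have rm : (r < n0 + m)%N by rewrite ltn_add2l ltn_mod.
  have := superadditive_iter q sa nm (leq_addr _ _ : (n0 <= r)%N).
  rewrite -nE; apply: le_trans.
  have := c_le _ rm; suff : n%:R * (a m / m%:R) <= q%:R * a m + (n0 + m)%:R * `|a m / m%:R|.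
    by rewrite /K; lra.
  rewrite [in leLHS]nE natrD natrM mulrDl.
  have -> : q%:R * m%:R * (a m / m%:R) = q%:R * a m by field; rewrite lt0r_neq0.
  rewrite lerD2l (le_trans (ler_norm _))// normrM ler_wpM2r//.
  by rewrite ger0_norm// ler_nat ltnW.
near=> n.
have nn : (n0 <= n)%N by near: n; exists n0.
have n0R : 0 < n%:R :> R by rewrite ltr0n; exact: leq_trans nn.
have Kn : K < (e / 2) * n%:R.
  rewrite mulrC -ltr_pdivrMr//.
  by near: n; exact: nbhs_infty_gtr.
rewrite ger0_norm ?subr_ge0 ?ubE//.
have : a m / m%:R - e / 2 < a n / n%:R; last by lra.
rewrite ltr_pdivlMr//; have := lower _ nn; nra.
Unshelve. all: end_near. Qed.

(** Fekete applied to [ln S] makes [l ^+ n] an upper bound of [S n]. Conversely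
    [S (k * n) <= C * G n ^+ k], and taking k-th roots as [k] grows removes [C]. Both bounds are
    free of subexponential errors. *)
Lemma growth_rate (S G : nat -> R) (C : R) : 0 < C ->
  (forall n, (0 < n)%N -> 0 < S n) -> (forall n, 0 < G n) ->
  (forall n m, (0 < n)%N -> (0 < m)%N -> S n * S m <= S (n + m)%N) ->
  (forall n m, G (n + m)%N <= G n * G m) ->
  (forall n, (0 < n)%N -> S n <= C * G n) ->
  exists2 l : R, 0 < l & forall n, (0 < n)%N -> S n <= l ^+ n /\ l ^+ n <= G n.
Proof.
move=> C0 S0 G0 SM GM SG.
have Gpow n k : G (k.+1 * n)%N <= G n ^+ k.+1.
  elim: k => [|k IH]; first by rewrite mul1n expr1.
  rewrite mulSn exprS (le_trans (GM _ _))// ler_wpM2l//; exact: ltW.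
(* The linear upper bound comes from [S n <= C * G 1 ^+ n]. *)
have [||l lim lub] := @fekete (fun n => ln (S n)) 1 (`|ln C| + `|ln (G 1%N)|) isT.
- by move=> n m nn mm; rewrite -lnM ?posrE ?S0// ler_ln ?posrE ?SM ?mulr_gt0 ?S0 ?addn_gt0 ?nn.
- move=> [|n]// _; apply: (@le_trans _ _ (ln (C * G 1%N ^+ n.+1))).
    rewrite ler_ln ?posrE ?S0 ?mulr_gt0 ?exprn_gt0// (le_trans (SG _ _))//.
    by rewrite ler_wpM2l ?(ltW C0)//; have := Gpow 1%N n; rewrite muln1.
  rewrite lnM ?posrE ?exprn_gt0// lnXn// -[_ *+ n.+1]mulr_natr mulrDl lerD//.
    by rewrite (le_trans (ler_norm _))// ler_peMr// ?ler1n.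
  by rewrite ler_wpM2r// ler_norm.
exists (expR l); first exact: expR_gt0.
move=> n n0; rewrite -expRM_natl; split.
  rewrite -[leLHS]lnK ?posrE ?S0// ler_expR mulrC; exact: lub.
rewrite -[leRHS]lnK ?posrE// ler_expR.
have key k : n%:R * (ln (S (k.+1 * n)%N) / (k.+1 * n)%:R) <= ln (G n) + k.+1%:R^-1 * ln C.
  have kn0 : (0 < k.+1 * n)%N by rewrite muln_gt0.
  have -> : n%:R * (ln (S (k.+1 * n)%N) / (k.+1 * n)%:R) = k.+1%:R^-1 * ln (S (k.+1 * n)%N).
    have nk0 : k.+1%:R != 0 :> R by rewrite pnatr_eq0.
    have nn0 : n%:R != 0 :> R by rewrite pnatr_eq0 -lt0n.
    rewrite natrM; move: nk0 nn0 (ln _); move: (k.+1%:R) (n%:R) => u v u0 v0 w.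
    by field; rewrite u0.
  rewrite -[ln (G n)](mulKf (_ : k.+1%:R != 0)) ?pnatr_eq0// -mulrDr ler_wpM2l//.
  rewrite mulr_natl -lnXn// -lnM ?posrE ?exprn_gt0//.
  rewrite ler_ln ?posrE ?S0 ?mulr_gt0 ?exprn_gt0// mulrC (le_trans (SG _ _))//.
  by rewrite ler_wpM2l ?(ltW C0).
have lim1 : n%:R * (ln (S (k.+1 * n)%N) / (k.+1 * n)%:R) @[k --> \oo] --> n%:R * l.
  apply: cvgMr.
  apply: (@cvg_comp _ _ _ (fun k => (k.+1 * n)%N) (fun j => ln (S j) / j%:R) _ _ _ _ lim).
  move=> A [N _ NA]; exists N => // k /= Nk; apply: NA => /=.
  by rewrite (leq_trans Nk)// (leq_trans (leqnSn _))// leq_pmulr.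
have lim2 : ln (G n) + k.+1%:R^-1 * ln C @[k --> \oo] --> ln (G n) + 0 * ln C.
  by apply: cvgD; [exact: cvg_cst|apply: cvgMl; exact: cvg_harmonic].
rewrite -[leRHS]addr0 -(mul0r (ln C)).
by apply: (ler_cvg_to lim1 lim2); exact: nearW.
Qed.

End fekete.

(** * Growth rate of the transfer operator *)

Section perron.
Context (R : realType) (e1 h : R -> R) (d c0 Ch C1 H H1 : R).
Local Notation leb := (@lebesgue_measure R).
Local Notation RR := (measurableTypeR R).
Hypotheses (me : measurable_fun [set: RR] (e1 : RR -> R)) (e_gt0 : forall x, 0 < e1 x).
Hypotheses (eC1 : forall x, e1 x <= C1)
  (e_decay : forall k : R, 0 < k -> exists L : R, forall x, L <= `|x| -> e1 x <= k).
Hypotheses (mh : measurable_fun [set: RR] (h : RR -> R)) (h0 : forall x, 0 <= h x).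
Hypotheses (hCh : forall x, h x <= Ch) (hH : (\int[leb]_x (h x)%:E <= H%:E)%E)
  (hH1 : (\int[leb]_x (`|x| * h x)%:E <= H1%:E)%E).
Hypotheses (d_gt0 : 0 < d) (c0_gt0 : 0 < c0)
  (hc : forall x, `|x| <= 2 * d -> c0 <= h x).
Local Open Scope ereal_scope.
Local Notation T := (transfer e1 h).
Local Notation J := (fun y : RR => (ind d y)%:E).
Local Notation one := (fun _ : RR => 1%:E : \bar R).
Implicit Types f g : RR -> \bar R.

Let e_ge0 x : (0 <= e1 x)%R. Proof. exact: ltW. Qed.
Let nJ : nnm J. Proof. exact: nnm_ind. Qed.
Let n1 : nnm one. Proof. exact: nnm_cst. Qed.
Let nT f : nnm f -> nnm (T f : RR -> \bar R). Proof. exact: nnm_transfer. Qed.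
Let nTn n f : nnm f -> nnm (iter n T f : RR -> \bar R). Proof. exact: nnm_iter. Qed.
Let nh x : nnm (fun y : RR => (h (y - x)%R)%:E).
Proof. by apply: nnm_EFin => // ; exact: measurable_subc. Qed.
Let C1_ge0 : (0 <= C1)%R. Proof. exact: le_trans (e_ge0 0) (eC1 0). Qed.
Let Ch_ge0 : (0 <= Ch)%R. Proof. exact: le_trans (h0 0) (hCh 0). Qed.

Lemma int_hsub x : \int[leb]_y (h (y - x)%R)%:E <= H%:E.
Proof.
rewrite (@int_shift R (fun y => (h y)%:E) (- x)%R)//; exact: nnm_EFin.
Qed.

Let H_ge0 : (0 <= H)%R.
Proof.
by rewrite -lee_fin; apply: le_trans hH; apply: integral_ge0 => x _; rewrite lee_fin.
Qed.

Lemma transfer_cst_le x (s : R) f : (0 <= s)%R -> nnm f -> (forall y, f y <= s%:E) ->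
  T f x <= (C1 * H * s)%:E.
Proof.
move=> s0 nf fs; apply: (@le_trans _ _ (\int[leb]_y ((C1 * s)%:E * (h (y - x)%R)%:E))).
  apply: int_le; [exact: nnm_kernelM| |move=> y].
    by apply: nnmM => //; apply: nnm_cst; rewrite mulr_ge0.
  apply: (@le_trans _ _ ((h (y - x) * e1 y)%:E * s%:E)).
    by rewrite lee_wpmul2l// lee_fin mulr_ge0.
  rewrite -!EFinM lee_fin [leRHS]mulrC -mulrA ler_wpM2l// ler_wpM2r//.
rewrite intZ//; last by rewrite lee_fin mulr_ge0.
rewrite (_ : (C1 * H * s)%R = (C1 * s * H)%R); last by ring.
by rewrite [leRHS]EFinM lee_wpmul2l ?int_hsub// lee_fin mulr_ge0.
Qed.

Lemma iter_one_le n x : iter n T one x <= ((C1 * H) ^+ n)%:E.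
Proof.
elim: n x => //= n IH x; rewrite exprS.
by apply: transfer_cst_le => //; [rewrite exprn_ge0// mulr_ge0|exact: nTn].
Qed.

Lemma dot_ind_le a (s : R) f : (0 <= a)%R -> (0 <= s)%R -> nnm f ->
  (forall y, f y <= s%:E) ->
  dot e1 (fun y => (ind a y)%:E) f <= (C1 * s * (2 * a))%:E.
Proof.
move=> a0 s0 nf fs.
apply: (@le_trans _ _ (\int[leb]_y ((C1 * s)%:E * (ind a y)%:E))).
  apply: int_le; [by apply: nnm_dot => //; exact: nnm_ind| |move=> y].
    by apply: nnmM; [apply: nnm_cst; rewrite mulr_ge0|exact: nnm_ind].
  rewrite (muleC (ind a y)%:E) muleA lee_wpmul2r ?lee_fin ?ind_ge0//.
  rewrite EFinM lee_pmul// ?lee_fin//; exact: nf.2.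
rewrite intZ//; [|exact: nnm_ind|by rewrite lee_fin mulr_ge0].
by rewrite integral_ind.
Qed.

(** Masses of the increment chain started in [[-d, d]]: the end is free in [massD] and confined to
    [[-d, d]] in [massE]. Up to constants and shifts of the index the first is submultiplicative and
    the second supermultiplicative. *)
Definition massD n : R := fine (dot e1 J (iter n T one)).
Definition massE n : R := fine (dot e1 J (iter n T J)).
Local Notation D := massD.
Local Notation E := massE.

Lemma massDE n : dot e1 J (iter n T one) = (D n)%:E.
Proof.
rewrite fineK// ge0_fin_numE; last by apply: dot_ge0 => //; exact: nTn.
apply: le_lt_trans (ltry _); apply: dot_ind_le; [exact: ltW| |exact: nTn|exact: iter_one_le].
by rewrite exprn_ge0// mulr_ge0.
Qed.

Lemma massEE n : dot e1 J (iter n T J) = (E n)%:E.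
Proof.
rewrite fineK// ge0_fin_numE; last by apply: dot_ge0 => //; exact: nTn.
apply: le_lt_trans (ltry (D n)); rewrite -massDE.
apply: dot_le => //; try exact: nTn.
by move=> x; apply: iter_le => // y; rewrite lee_fin ind_le1.
Qed.

Lemma massED n : (E n <= D n)%R.
Proof.
rewrite -lee_fin -massDE -massEE.
apply: dot_le => //; try exact: nTn.
by move=> x; apply: iter_le => // y; rewrite lee_fin ind_le1.
Qed.

Lemma massE_ge0 n : (0 <= E n)%R.
Proof. by rewrite -lee_fin -massEE; apply: dot_ge0 => //; exact: nTn. Qed.

Lemma massE0_gt0 : (0 < E 0)%R.
Proof.
have [k k0 hk] := density_itv me e_gt0 d (mulr_gt0 (ltr0n _ 2) d_gt0).
rewrite -lte_fin -massEE; apply: (@lt_le_trans _ _ k%:E); first by rewrite lte_fin.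
apply: le_trans (hk (- d)%R d _ _ _) _ => //; first lra.
rewrite le_eqVlt; apply/orP; left; apply/eqP; apply: eq_integral => y _ /=; rewrite -!EFinM -ler_norml /ind.
by case: (_ <= _)%R; rewrite ?mul1r ?mulr1 ?mul0r ?mulr0.
Qed.

(** Doeblin minorisation: two points of [[-d, d]] are at distance at most [2 * d], where [h] is at
    least [c0], so [T] dominates an operator of rank one. *)
Lemma transfer_ge_J f x : nnm f -> (c0%:E * dot e1 J f) * J x <= T f x.
Proof.
move=> nf; rewrite /ind; have [xd|_] := boolP (`|x| <= d)%R; last first.
  by rewrite mule0; apply: (nT nf).2.
rewrite mule1 /dot -intZ; [|exact: nnm_dot|by rewrite lee_fin ltW].
apply: int_le => [||y].
- by apply: nnmM; [apply: nnm_cst; exact: ltW|exact: nnm_dot].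
- exact: nnm_kernelM.
rewrite /ind; have [yd|_] := boolP (`|y| <= d)%R; last first.
  by rewrite mul0e !mule0 mule_ge0// ?lee_fin ?mulr_ge0//; exact: nf.2.
rewrite mul1e muleA lee_wpmul2r//; first exact: nf.2.
rewrite -EFinM lee_fin ler_wpM2r// hc//.
by rewrite (le_trans (ler_normB _ _))//; lra.
Qed.

Lemma massD_succ n : (c0 * E 0 * D n <= D n.+1)%R.
Proof.
rewrite -lee_fin -(massDE n.+1) /=.
have cD0 : 0%R <= c0%:E * (D n)%:E.
  rewrite mule_ge0// ?lee_fin ?(ltW c0_gt0)//.
  by rewrite (le_trans (massE_ge0 n))// massED.
apply: (@le_trans _ _ (dot e1 J (fun x => (c0%:E * (D n)%:E) * J x))).
  by rewrite dotZ// (massEE 0) -!EFinM lee_fin; lra.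
apply: dot_le => //.
- by apply: nnmM => //; split => //.
- by apply: nT; exact: nTn.
- by move=> x; rewrite -massDE; apply: transfer_ge_J; exact: nTn.
Qed.

(** The additional step joins the end of one confined path to the start of the other through the
    rank-one minorisation. *)
Lemma massE_mul n m : (c0 * E n * E m <= E (n + m).+1)%R.
Proof.
rewrite -lee_fin -massEE -addnS iterD /=.
have cE0 : 0%R <= c0%:E * (E m)%:E.
  by rewrite mule_ge0// ?lee_fin ?(ltW c0_gt0)// massE_ge0.
have nc : nnm (fun x : RR => (c0%:E * (E m)%:E) * J x).
  by apply: nnmM => //; split.
apply: (@le_trans _ _ (dot e1 J (iter n T (fun x => (c0%:E * (E m)%:E) * J x)))).
  rewrite (_ : iter n T _ = (fun x => (c0%:E * (E m)%:E) * iter n T J x)).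
    by rewrite dotZ//; [rewrite massEE -!EFinM lee_fin; lra|exact: nTn].
  by apply/funext => x; rewrite iter_transferZ.
apply: dot_le => //; [exact: nTn|by apply: nTn; apply: nT; exact: nTn|].
move=> x; apply: iter_le => //; first by apply: nT; exact: nTn.
by move=> y; rewrite -massEE; apply: transfer_ge_J; exact: nTn.
Qed.

#[local] Opaque massD massE.

Lemma massD_gt0 n : (0 < D n)%R.
Proof.
elim: n => [|n IH]; first exact: lt_le_trans massE0_gt0 (massED 0).
by apply: lt_le_trans (massD_succ n); rewrite !mulr_gt0// massE0_gt0.
Qed.

(** Growth factor guaranteed by one minorised step, by [massD_succ]; the weight of excursions will
    be compared with it. *)
Let kap := (c0 * E 0)%R.
Let kap_gt0 : (0 < kap)%R. Proof. by rewrite mulr_gt0// massE0_gt0. Qed.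

Lemma massD_mono n m : (kap ^+ m * D n <= D (n + m))%R.
Proof.
elim: m => [|m IH]; first by rewrite expr0 mul1r addn0.
rewrite addnS (le_trans _ (massD_succ _))// exprS -mulrA ler_wpM2l//.
exact: ltW.
Qed.

(** Inside [[-L, L]] the kernel is at most [Ch], which leaves a pairing that masses can bound;
    outside, [e1 <= r] and the supremum of [f] suffices. *)
Lemma transfer_split (L r s : R) f x : (0 <= r)%R -> (0 <= s)%R ->
  (forall y, L <= `|y| -> e1 y <= r)%R -> nnm f -> (forall y, f y <= s%:E) ->
  T f x <= Ch%:E * dot e1 (fun y => (ind L y)%:E) f + (r * H * s)%:E.
Proof.
move=> r0 s0 Lr nf fs.
have nI : nnm (fun y : RR => (ind L y)%:E) by exact: nnm_ind.
have nd := nnm_dot me e_gt0 nf nI.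
apply: (@le_trans _ _ (\int[leb]_y (Ch%:E * ((e1 y)%:E * ((ind L y)%:E * f y))
    + (r * s)%:E * (h (y - x)%R)%:E))).
  apply: int_le; [exact: nnm_kernelM| |move=> y].
    apply: nnmD; apply: nnmM => //; apply: nnm_cst => //; exact: mulr_ge0.
  rewrite /ind; case: (leP `|y|%R L) => [yL|/ltW yL].
    rewrite mul1e -[leLHS]adde0 leeD// ?lee_fin ?mulr_ge0// muleA lee_wpmul2r//; first exact: nf.2.
    by rewrite -EFinM lee_fin ler_wpM2r.
  rewrite mul0e !mule0 add0e; apply: (@le_trans _ _ ((h (y - x) * e1 y)%:E * s%:E)).
    by rewrite lee_wpmul2l// lee_fin mulr_ge0.
  rewrite -!EFinM lee_fin [leRHS]mulrC -mulrA ler_wpM2l// ler_wpM2r// Lr//.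
rewrite intD; last 2 first.
- by apply: nnmM => //; exact: nnm_cst.
- by apply: nnmM => //; apply: nnm_cst; exact: mulr_ge0.
rewrite intZ// leeD2l// intZ//; last by rewrite lee_fin mulr_ge0.
rewrite (_ : (r * H * s)%R = (r * s * H)%R); last by ring.
by rewrite [leRHS]EFinM lee_wpmul2l ?int_hsub// lee_fin mulr_ge0.
Qed.

Lemma transfer_one_split (L r : R) x : (0 <= r)%R ->
  (forall y, L <= `|y| -> e1 y <= r)%R ->
  T one x <= T (fun y => (ind L y)%:E) x + (r * H)%:E.
Proof.
move=> r0 Lr; have nI : nnm (fun y : RR => (ind L y)%:E) by exact: nnm_ind.
apply: (@le_trans _ _ (\int[leb]_y ((h (y - x) * e1 y)%:E * (ind L y)%:E
    + r%:E * (h (y - x)%R)%:E))).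
  apply: int_le; [exact: nnm_kernelM| |move=> y].
    apply: nnmD; first exact: nnm_kernelM.
    by apply: nnmM => //; exact: nnm_cst.
  rewrite -!EFinM -EFinD lee_fin mulr1 /ind; case: (leP `|y|%R L) => [yL|/ltW yL].
    by rewrite mulr1 lerDl mulr_ge0.
  by rewrite mulr0 add0r mulrC ler_wpM2r// Lr.
rewrite intD; [|exact: nnm_kernelM|by apply: nnmM => //; exact: nnm_cst].
rewrite intZ// leeD2l// EFinM lee_wpmul2l// int_hsub//.
Qed.

(* Outside a large interval [-L, L] the weight [e1] is so small that the mass
   spent there is dominated by the mass of paths confined near [0]. *)
Lemma excursion_bounds : exists p : nat, exists K K' : R, [/\ (0 < p)%N, (0 < K)%R,
  (0 < K')%R, (forall n x, iter n T one x <= (K * D (n + p))%:E) &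
  forall n, (D n.+1 <= K' * E (n.+1 + p))%R].
Proof.
(* A step outside [[-L, L]] then multiplies the mass by at most [r * H <= kap / 2], half of what a
   confined step guarantees; [H + 1] keeps the divisor positive. *)
pose r := (kap / (2 * (H + 1)))%R.
have r_gt0 : (0 < r)%R by rewrite divr_gt0// mulr_gt0// ltr_wpDl.
have rH : (r * H <= kap / 2)%R.
  have H10 : (0 < 2 * (H + 1))%R by rewrite mulr_gt0// ltr_wpDl.
  have : (r * (2 * (H + 1)) = kap)%R by rewrite /r divfK// gt_eqF.
  lra.
have [L Lr] := e_decay r_gt0.
have nI : nnm (fun y : RR => (ind L y)%:E) by exact: nnm_ind.
pose q := Num.truncn (`|L| / (d / 2)).
have qL : (L <= q.+2%:R * (d / 2))%R.
  have d20 : (0 < d / 2)%R by rewrite divr_gt0.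
  rewrite (le_trans (ler_norm _))// -ler_pdivrMr//.
  by rewrite (le_trans (ltW (truncnS_gt _)))// ler_nat.
have [cb cb_gt0 bridge] := transfer_bridge me e_gt0 mh h0 d_gt0 c0_gt0 hc q.
(* A bridge from [[-d, d]] out to [[-L, L]] is, by adjointness, a bridge back to [[-d, d]] for the
   reflected kernel, whose lower bound near 0 is the same. *)
pose h' := fun u => h (- u)%R.
have mh' : measurable_fun [set: RR] (h' : RR -> R).
  by apply: (measurableT_comp mh); mreal.
have h'0 x : (0 <= h' x)%R by exact: h0.
have h'c x : (`|x| <= 2 * d -> c0 <= h' x)%R by move=> xd; apply: hc; rewrite normrN.
have [cb' cb'_gt0 bridge'] := transfer_bridge me e_gt0 mh' h'0 d_gt0 c0_gt0 h'c q.
pose p := q.+1.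
have dotI f : nnm f -> cb'%:E * dot e1 (fun y => (ind L y)%:E) f <= dot e1 J (iter p T f).
  move=> nf; rewrite dot_iter// dotC -dotZ//; last by rewrite lee_fin ltW.
  have nT' := nnm_iter me e_gt0 mh' h'0 p nJ.
  apply: dot_le => //.
    by apply: nnmM => //; apply: nnm_cst; exact: ltW.
  move=> y; rewrite /ind; case: (leP `|y|%R L) => [yL|_].
    by rewrite mule1; apply: bridge'; exact: le_trans yL qL.
  by rewrite mule0; exact: nT'.2.
(* The first summand makes the contribution of [[-L, L]] at most [K / 2 * (kap * D (n + p))], the
   other half being left to the outside; the second summand starts the induction, since
   [1 <= K * D p]. *)
pose K := (2 * Ch / (cb' * kap) + (D p)^-1)%R.
have A0 : (0 <= 2 * Ch / (cb' * kap))%R.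
  by apply: divr_ge0; apply: mulr_ge0 => //; exact: ltW.
have K_gt0 : (0 < K)%R.
  by apply: ltr_wpDl => //; rewrite invr_gt0 massD_gt0.
exists p, K, (2 / cb)%R; split => //; first by rewrite divr_gt0.
  elim=> [|n IH] x.
    rewrite /= lee_fin add0n /K mulrDl mulVf ?gt_eqF ?massD_gt0// lerDr.
    by rewrite mulr_ge0// ltW// massD_gt0.
  have KD0 : (0 <= K * D (n + p))%R by rewrite mulr_ge0// ltW// massD_gt0.
  rewrite [iter _ _ _ _]/=; apply: le_trans (transfer_split x (ltW r_gt0) KD0 Lr _ IH) _; first exact: nTn.
  have dI : dot e1 (fun y => (ind L y)%:E) (iter n T one) <= (cb'^-1 * D (n + p))%:E.
    rewrite EFinM -massDE addnC iterD.
    by rewrite lee_pdivlMl//; apply: dotI; exact: nTn.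
  apply: (@le_trans _ _ (Ch * (cb'^-1 * D (n + p)) + r * H * (K * D (n + p)))%:E).
    by rewrite EFinD leeD2r// EFinM lee_wpmul2l.
  rewrite lee_fin.
  have DS := massD_succ (n + p); rewrite -/kap in DS.
  rewrite addSn; apply: (@le_trans _ _ (K * (kap * D (n + p)))%R); last first.
    by rewrite ler_wpM2l// ltW.
  have -> : (Ch * (cb'^-1 * D (n + p)) = (Ch / (cb' * kap)) * (kap * D (n + p)))%R.
    by field; rewrite !gt_eqF.
  set X := (kap * D (n + p))%R; have X0 : (0 <= X)%R by rewrite mulr_ge0// ltW// massD_gt0.
  have : (r * H * (K * D (n + p)) <= K / 2 * X)%R.
    rewrite /X (_ : K / 2 * _ = kap / 2 * (K * D (n + p)))%R; last by ring.
    by rewrite ler_wpM2r.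
  have : (2 * Ch / (cb' * kap) * X <= K * X)%R.
    by apply: ler_wpM2r => //; rewrite /K lerDl invr_ge0; exact/ltW/massD_gt0.
  lra.
move=> n.
(* After iteration and pairing with [J], the last term is at most [kap / 2 * D n], hence at most
   half of [D n.+1], and is absorbed on the left; this is the 2 in [2 / cb]. *)
have step x : T one x <= cb^-1%:E * iter p.+1 T J x + (r * H)%:E * one x.
  rewrite mule1; apply: le_trans (transfer_one_split x (ltW r_gt0) Lr) _.
  rewrite leeD2r// [iter _ _ _ _]/= -transferZ//; last 2 first.
  - exact: (nTn p nJ).
  - by rewrite lee_fin invr_ge0 ltW.
  apply: transfer_le => //.
    by apply: nnmM; [apply: nnm_cst; rewrite invr_ge0 ltW|exact: (nTn p nJ)].
  move=> y; have IJ : cb%:E * (ind L y)%:E <= iter p T J y.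
    rewrite /ind; case: (leP `|y|%R L) => [yL|_]; last by rewrite mule0; apply: (nTn p nJ).2.
    by rewrite mule1; apply: bridge; exact: le_trans yL qL.
  by rewrite lee_pdivlMl.
have rH0 : (0 <= r * H)%R by rewrite mulr_ge0// ltW.
have nA : nnm (fun y => cb^-1%:E * iter p.+1 T J y).
  by apply: nnmM; [apply: nnm_cst; rewrite invr_ge0 ltW|exact: (nTn p.+1 nJ)].
have nB : nnm (fun y => (r * H)%:E * one y) by apply: nnmM => //; exact: nnm_cst.
have cbi0 : 0 <= cb^-1%:E by rewrite lee_fin invr_ge0 ltW.
have rHE : 0 <= (r * H)%:E by rewrite lee_fin.
have main : dot e1 J (iter n.+1 T one) <=
    cb^-1%:E * dot e1 J (iter (n + p.+1) T J) + (r * H)%:E * dot e1 J (iter n T one).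
  apply: (@le_trans _ _ (dot e1 J (iter n T (fun y => cb^-1%:E * iter p.+1 T J y + (r * H)%:E * one y)))).
    rewrite iterSr; apply: dot_le => //.
    - by apply: nTn; exact: nT.
    - by apply: nTn; exact: nnmD.
    - by move=> x; apply: iter_le => //; [exact: nT|exact: nnmD].
  rewrite (_ : iter n T _ = fun x => cb^-1%:E * iter n T (iter p.+1 T J) x + (r * H)%:E * iter n T one x).
    rewrite dotD//; last 2 first.
    - by apply: nnmM; [apply: nnm_cst; rewrite invr_ge0 ltW|apply: nTn; exact: (nTn p.+1 nJ)].
    - by apply: nnmM; [exact: nnm_cst|exact: nTn].
    by rewrite !dotZ//; [rewrite iterD|exact: nTn|apply: nTn; exact: (nTn p.+1 nJ)].
  apply/funext => x; rewrite iter_transferD// iter_transferZ//; last exact: (nTn p.+1 nJ).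
  by rewrite iter_transferZ.
move: main; rewrite !massDE massEE -!EFinM -EFinD lee_fin addSnnS => main.
have := massD_succ n; rewrite -/kap => DS.
have rHD : (r * H * D n <= kap / 2 * D n)%R.
  by rewrite ler_wpM2r// ltW// massD_gt0.
by rewrite -mulrA; lra.
Qed.

Local Notation psi := (fun x : RR => (`|x|%R)%:E).

Let npsi : nnm psi.
Proof. by apply: nnm_EFin => // ; mreal. Qed.

(** Lyapunov drift for the absolute value: either [|y| <= L], or the weight is at most [r] and
    [|y| <= |x| + |y - x|]. The coefficient [r * H] of [|x|] will be at most half the growth
    rate. *)
Lemma transfer_psi_le (L r : R) x : (0 <= r)%R ->
  (forall y, L <= `|y| -> e1 y <= r)%R ->
  T psi x <= ((C1 * `|L| + r * `|x|) * H + r * H1)%:E.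
Proof.
move=> r0 Lr.
pose G (u : RR) := (`|u| * h u)%:E.
have nG : nnm G.
  by apply: nnm_EFin => [|y]; [mreal|rewrite mulr_ge0].
have nGx : nnm (fun y : RR => G (y - x)%R).
  by apply: nnm_EFin => [|y]; [mreal; exact: measurable_subc|rewrite mulr_ge0].
have A0 : (0 <= C1 * `|L| + r * `|x|)%R by rewrite addr_ge0// mulr_ge0.
apply: (@le_trans _ _ (\int[leb]_y ((C1 * `|L| + r * `|x|)%:E * (h (y - x)%R)%:E
    + r%:E * G (y - x)%R))).
  apply: int_le; [exact: nnm_kernelM| |move=> y].
    by apply: nnmD; apply: nnmM => //; exact: nnm_cst.
  rewrite /G -!EFinM -EFinD lee_fin.
  have key : (e1 y * `|y| <= C1 * `|L| + r * (`|x| + `|y - x|))%R.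
    have [yL|/ltW Ly] := leP `|y|%R L.
      rewrite ler_wpDr ?mulr_ge0 ?addr_ge0// ler_pM//.
      exact: le_trans (ler_norm _).
    rewrite ler_wpDl ?mulr_ge0// ler_pM// ?Lr//.
    by have := ler_normD x (y - x)%R; rewrite (addrC x) subrK.
  by rewrite -mulrA; apply: le_trans (ler_wpM2l (h0 _) key) _; lra.
rewrite intD; last 2 first.
- by apply: nnmM => //; exact: nnm_cst.
- by apply: nnmM => //; exact: nnm_cst.
rewrite intZ ?lee_fin// intZ ?lee_fin// [leRHS]EFinD; apply: leeD.
  by rewrite [leRHS]EFinM lee_wpmul2l ?lee_fin ?int_hsub.
rewrite [leRHS]EFinM lee_wpmul2l ?lee_fin//.
by rewrite (@int_shift R G (- x)%R).
Qed.

(** [growth_rate] bounds confined masses from above and free masses from below by powers of [l];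
    [excursion_bounds] compares [D] with a later [E], so that both sequences are trapped from both
    sides. *)
Lemma perron : exists l C c : R, exists n0 : nat, [/\ (0 < l)%R, (0 < C)%R, (0 < c)%R,
  (forall n x, iter n T one x <= (C * l ^+ n)%:E) &
  (forall n, (n0 <= n)%N -> (c * l ^+ n)%:E <= dot e1 J (iter n T J)) /\
  (forall n x, iter n T psi x <= (l ^+ n * (`|x| + C))%:E)].
Proof.
have [[|p'] [K [K' [p0 K0 K'0 bD bE]]]] := excursion_bounds; first by [].
pose p := p'.+1; rewrite -/p in bD bE.
(* Joining two confined paths costs one step and a factor [c0]: the shifted index and the factor
   make [S] exactly supermultiplicative. The shift [p] and the factor [K] do the same for the
   submultiplicativity of [G]. *)
pose S n := (c0 * E n.-1)%R.
pose G n := (K * D (n + p))%R.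
have E0 n : (0 < E n)%R.
  elim: n => [|n IH]; first exact: massE0_gt0.
  have := massE_mul n 0; rewrite addn0; apply: lt_le_trans.
  by rewrite !mulr_gt0// massE0_gt0.
have DM n m : (D (n + m) <= K * D (m + p) * D n)%R.
  rewrite -lee_fin EFinM -!massDE.
  have KD : (0 <= K * D (m + p))%R by rewrite mulr_ge0 ?ltW// massD_gt0.
  rewrite -dotZ//; last by exact: nTn.
  apply: dot_le => //; [exact: nTn|by apply: nnmM; [exact: nnm_cst|exact: nTn]|].
  move=> x; rewrite -iter_transferZ// iterD; apply: iter_le => //; first exact: nTn.
    by apply: nnmM => //; exact: nnm_cst.
  by move=> y; rewrite mule1.
have SG n : (0 < n)%N -> (S n <= c0 / (kap ^+ p.+1 * K) * G n)%R.
  case: n => // n _; rewrite /S /G [n.+1.-1]/=.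
  have a0 : (0 < kap ^+ p.+1)%R by rewrite exprn_gt0.
  have := massD_mono n p.+1; rewrite addnS -addSn.
  move: (kap ^+ p.+1)%R a0 (D (n.+1 + p)) => a a0 X Xa.
  have -> : (c0 / (a * K) * (K * X) = c0 * (X / a))%R by field; rewrite !lt0r_neq0.
  rewrite ler_wpM2l ?(ltW c0_gt0)// ler_pdivlMr// mulrC (le_trans _ Xa)//.
  by rewrite ler_wpM2l ?(ltW a0)// massED.
have S0 n : (0 < n)%N -> (0 < S n)%R by move=> _; rewrite mulr_gt0.
have G0 n : (0 < G n)%R by rewrite mulr_gt0 ?massD_gt0.
have [|n m n0 m0|n m|l l0 lSG] := growth_rate _ S0 G0 _ _ SG.
- by rewrite divr_gt0// mulr_gt0// exprn_gt0.
- case: n m n0 m0 => // n [|m]// _ _; rewrite /S addSn addnS/=.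
  rewrite (_ : _ * (c0 * E m) = c0 * (c0 * E n * E m))%R; last by ring.
  by rewrite ler_wpM2l ?(ltW c0_gt0)// massE_mul.
- rewrite /G -addnA addnC -addnA (addnC p) addnC.
  by rewrite (le_trans (ler_wpM2l (ltW K0) (DM (n + p)%N m)))//; lra.
have kapl : (kap <= l)%R by have [] := lSG 1%N isT.
have P1 n : (G n <= K * K' / c0 * l ^+ (p + p).+1 * l ^+ n)%R.
  rewrite -[leRHS]mulrA -exprD.
  have [Sl _] := lSG (n + p + p).+1 isT.
  rewrite (_ : ((p + p).+1 + n = (n + p + p).+1)%N); last by rewrite addSn addnC addnA.
  have DE := bE (n + p')%N; rewrite -addnS -/p in DE.
  rewrite /G.
  apply: le_trans (ler_wpM2l (ltW K0) DE) _.
  have -> : (K * (K' * E (n + p + p)) = K * K' / c0 * (c0 * E (n + p + p)))%R.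
    by field; rewrite lt0r_neq0.
  by apply: ler_wpM2l Sl; rewrite divr_ge0 ?mulr_ge0 ?(ltW K0) ?(ltW K'0) ?(ltW c0_gt0).
pose C := (K * K' / c0 * l ^+ (p + p).+1)%R.
have C_gt0 : (0 < C)%R.
  apply: mulr_gt0; last exact: exprn_gt0.
  by apply: divr_gt0 => //; exact: mulr_gt0.
have one_le n x : iter n T one x <= (C * l ^+ n)%:E.
  by apply: le_trans (bD n x) _; rewrite lee_fin; exact: P1.
pose r := (kap / (2 * (H + 1)))%R.
have r_gt0 : (0 < r)%R by rewrite divr_gt0// mulr_gt0// ltr_wpDl.
have rH : (r * H <= kap / 2)%R.
  have H10 : (0 < 2 * (H + 1))%R by rewrite mulr_gt0// ltr_wpDl.
  have : (r * (2 * (H + 1)) = kap)%R by rewrite /r divfK// gt_eqF.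
  lra.
have [L Lr] := e_decay r_gt0.
have H1_ge0 : (0 <= H1)%R.
  rewrite -lee_fin; apply: le_trans hH1.
  by apply: integral_ge0 => x _; rewrite lee_fin mulr_ge0.
pose A := (C1 * `|L| * H + r * H1)%R.
have A0 : (0 <= A)%R.
  by apply: addr_ge0; apply: mulr_ge0 => //; [exact: mulr_ge0|exact: ltW].
(* Chosen so that [A * C = l / 2 * C2]; with [r * H <= kap / 2 <= l / 2], the form
   [l ^+ n * (|x| + C2)] of the bound is then preserved by one more step. *)
pose C2 := (2 * A * C / l)%R.
have C20 : (0 <= C2)%R.
  by apply: divr_ge0; [apply: mulr_ge0; [exact: mulr_ge0|exact: ltW]|exact: ltW].
have rH0 : (0 <= r * H)%R by apply: mulr_ge0 => //; exact: ltW.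
have psi_le n x : iter n T psi x <= (l ^+ n * (`|x| + C2))%:E.
  elim: n x => [|n IH] x; first by rewrite /= lee_fin expr0 mul1r lerDl.
  rewrite iterSr; apply: (@le_trans _ _ (iter n T (fun y => (r * H)%:E * psi y + A%:E * one y) x)).
    apply: iter_le => //; first exact: nT.
      by apply: nnmD; apply: nnmM => //; exact: nnm_cst.
    move=> y; apply: le_trans (transfer_psi_le y (ltW r_gt0) Lr) _.
    by rewrite mule1 -EFinM -EFinD lee_fin /A; lra.
  rewrite iter_transferD//; last 2 first.
  - by apply: nnmM => //; exact: nnm_cst.
  - by apply: nnmM => //; exact: nnm_cst.
  rewrite !iter_transferZ//.
  apply: (@le_trans _ _ ((r * H)%:E * (l ^+ n * (`|x| + C2))%:E + A%:E * (C * l ^+ n)%:E)).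
    by apply: leeD; apply: lee_wpmul2l; rewrite ?lee_fin.
  rewrite -!EFinM -EFinD lee_fin exprS.
  have ln0 : (0 <= l ^+ n)%R by apply: exprn_ge0; exact: ltW.
  have AC : (A * C = C2 * (l / 2))%R by rewrite /C2; field; rewrite lt0r_neq0.
  rewrite (_ : (_ + _ = l ^+ n * (r * H * (`|x| + C2) + A * C))%R); last by ring.
  rewrite (_ : l * l ^+ n * _ = l ^+ n * (l * (`|x| + C2)))%R; last by ring.
  rewrite ler_wpM2l// AC.
  have u0 : (0 <= `|x| + C2)%R by apply: addr_ge0.
  have s1 : (r * H * (`|x| + C2) <= l / 2 * (`|x| + C2))%R by apply: ler_wpM2r => //; lra.
  have s2 : (0 <= l * `|x|)%R by apply: mulr_ge0 => //; exact: ltW.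
  by apply: le_trans (lerD s1 (lexx _)) _; lra.
exists l, (C + C2)%R, (l ^- (p + p) / (K * K'))%R, (p + p).+1; split => //.
- exact: ltr_wpDr.
- by apply: divr_gt0; [rewrite invr_gt0 exprn_gt0|exact: mulr_gt0].
- move=> n x; apply: le_trans (one_le n x) _; rewrite lee_fin ler_wpM2r//.
    by apply: exprn_ge0; exact: ltW.
  by rewrite lerDl.
split=> n; last first.
  move=> x; apply: le_trans (psi_le n x) _; rewrite lee_fin ler_wpM2l//.
    by apply: exprn_ge0; exact: ltW.
  by rewrite lerD2l lerDr ltW.
move=> pn; rewrite massEE lee_fin.
have nE : n = (n - (p + p) + (p + p))%N by rewrite subnK// ltnW.
have k0 : (0 < n - (p + p))%N by rewrite subn_gt0.
set k := (n - (p + p))%N in nE k0.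
have DE := bE (k + p')%N; rewrite -addnS -/p -addnA -nE in DE.
rewrite (_ : l ^+ n = l ^+ k * l ^+ (p + p))%R; last by rewrite -exprD -nE.
have lp0 : (0 < l ^+ (p + p))%R by rewrite exprn_gt0.
have -> : (l ^- (p + p) / (K * K') * (l ^+ k * l ^+ (p + p)) = l ^+ k / (K * K'))%R.
  by field; rewrite !lt0r_neq0.
rewrite ler_pdivrMr ?mulr_gt0//.
have [_ lG] := lSG k k0; apply: le_trans lG _.
rewrite /G (_ : E n * (K * K') = K * (K' * E n))%R; last by ring.
by apply: ler_wpM2l => //; exact: ltW.
Qed.

End perron.

(** * Partition functions with prescribed initial heights *)

Section pinned_partition.
Context (R : realType) (e1 h : R -> R).
Local Notation leb := (@lebesgue_measure R).
Local Notation RR := (measurableTypeR R).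
Hypotheses (me : measurable_fun [set: RR] (e1 : RR -> R)) (e_gt0 : forall x, 0 < e1 x).
Hypotheses (mh : measurable_fun [set: RR] (h : RR -> R)) (h0 : forall x, 0 <= h x).
Local Open Scope ereal_scope.

(** Weight of appending height [c] to [a, b]: the gradient of the new bond and the Laplacian at [b].
    The bond between the two initial heights is not charged, as in the Hamiltonian, whose gradients
    start at index 1. *)
Definition stepw (a b c : R) : R := (e1 (c - b) * h (c + a - 2 * b))%R.

(* [pinZ eps n a b] is the weight of the paths starting at heights [a, b], followed
   by [n] free heights and then by the two boundary heights [0, 0]. *)
Fixpoint pinZ (eps : R) (n : nat) (a b : R) : \bar R :=
  match n with
  | 0%N => (stepw a b 0 * stepw b 0 0)%:E
  | n'.+1 => eps%:E * ((stepw a b 0)%:E * pinZ eps n' b 0) +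
             \int[leb]_c ((stepw a b c)%:E * pinZ eps n' b c)
  end.

Lemma stepw_ge0 a b c : (0 <= stepw a b c)%R.
Proof. by rewrite mulr_ge0// ltW. Qed.

Lemma measurable_stepw d (X : measurableType d) (u v t : X -> R) :
  measurable_fun [set: X] u -> measurable_fun [set: X] v -> measurable_fun [set: X] t ->
  measurable_fun [set: X] (fun x => stepw (u x) (v x) (t x)).
Proof.
move=> mu mv mt; apply: measurable_funM; first by apply: (measurableT_comp me); mreal.
by apply: (measurableT_comp mh); mreal.
Qed.

Lemma nnm_stepw d (X : measurableType d) (u v t : X -> R) :
  measurable_fun [set: X] u -> measurable_fun [set: X] v -> measurable_fun [set: X] t ->
  nnm (fun x => (stepw (u x) (v x) (t x))%:E).
Proof.
by move=> mu mv mt; apply: nnm_EFin => [|x]; [exact: measurable_stepw|exact: stepw_ge0].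
Qed.

Lemma nnm_pinZ (eps : R) n : (0 <= eps)%R -> nnm (fun p : RR * RR => pinZ eps n p.1 p.2).
Proof.
move=> eps0; elim: n => [|n IH] /=.
  apply: nnm_EFin => [|x]; last by rewrite mulr_ge0 ?stepw_ge0.
  by apply: measurable_funM; apply: measurable_stepw; mreal.
apply: nnmD.
  apply: nnmM; first exact: nnm_cst.
  apply: nnmM; first by apply: nnm_stepw; mreal.
  apply: (nnm_comp (f := fun p : RR * RR => pinZ eps n p.1 p.2) (g := fun p : RR * RR => (p.2, 0%R))) => //.
  by mreal.
apply: (@nnm_int _ _ _ leb (fun p : (RR * RR) * RR => (stepw p.1.1 p.1.2 p.2)%:E * pinZ eps n p.1.2 p.2)).
apply: nnmM.
  by apply: nnm_stepw; mreal.
apply: (nnm_comp (f := fun p : RR * RR => pinZ eps n p.1 p.2) (g := fun p : (RR * RR) * RR => (p.1.2, p.2))) => //.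
by mreal.
Qed.

Lemma nnm_pinZ2 (eps : R) n d (X : measurableType d) (u v : X -> R) : (0 <= eps)%R ->
  measurable_fun [set: X] u -> measurable_fun [set: X] v ->
  nnm (fun x => pinZ eps n (u x) (v x)).
Proof.
move=> eps0 mu mv.
apply: (nnm_comp (f := fun p : RR * RR => pinZ eps n p.1 p.2) (g := fun x => (u x, v x))).
  exact: measurable_fun_pair.
exact: nnm_pinZ.
Qed.

Lemma pinZ0S n a b : pinZ 0 n.+1 a b = \int[leb]_c ((stepw a b c)%:E * pinZ 0 n b c).
Proof. by rewrite /= mul0e add0e. Qed.

(* The substitution [c = b + y] followed by [b -> b - y]. *)
Lemma int_increment (theta : RR -> \bar R) (k : RR -> R) (Q : RR * RR -> \bar R) :
  nnm theta -> measurable_fun [set: RR] k -> (forall x, 0 <= k x)%R -> nnm Q ->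
  \int[leb]_b (theta b * \int[leb]_c ((k (c - b)%R)%:E * Q (b, c))) =
  \int[leb]_y ((k y)%:E * \int[leb]_b (theta (b - y)%R * Q (b - y, b)%R)).
Proof.
move=> nt mk k0 nQ.
have nk : nnm (fun y : RR => (k y)%:E) by exact: nnm_EFin.
have nQ2 (u v : RR * RR -> RR) : measurable_fun [set: RR * RR] u ->
    measurable_fun [set: RR * RR] v -> nnm (fun p => Q (u p, v p)).
  by move=> mu mv; apply: (nnm_comp (g := fun p => (u p, v p))) nQ; exact: measurable_fun_pair.
pose F (p : RR * RR) := theta p.1 * ((k p.2)%:E * Q (p.1, p.2 + p.1)%R).
have nF : nnm F.
  apply: nnmM; first exact: nnm_fst.
  by apply: nnmM; [exact: (nnm_snd nk)|apply: nQ2; mreal].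
transitivity (\int[leb]_b \int[leb]_y F (b, y)).
  apply: eq_integral => b _.
  have nG : nnm (fun c : RR => (k (c - b)%R)%:E * Q (b, c)).
    apply: nnmM; first by apply: nnm_EFin => //; exact: measurable_subc.
    by apply: (nnm_comp (g := fun c : RR => (b, c))) nQ; exact: measurable_pair1.
  rewrite -[X in _ * X](int_shift b nG) -intZ; last 2 first.
  - apply: nnmM; first by under eq_fun do rewrite addrK.
    by apply: (nnm_comp (g := fun y : RR => (b, y + b)%R)) nQ; mreal.
  - exact: nt.2.
  by apply: eq_integral => y _; rewrite /F/= addrK.
rewrite int_swap//; apply: eq_integral => y _.
have nG : nnm (fun b : RR => theta (b - y)%R * Q (b - y, b)%R).
  apply: nnmM; first by apply: nnm_comp nt; mreal.
  by apply: (nnm_comp (g := fun b : RR => (b - y, b)%R)) nQ; mreal.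
rewrite -[X in _ * X](int_shift y nG) -intZ//; last 2 first.
- apply: nnmM; first by under eq_fun do rewrite addrK.
  by apply: (nnm_comp (g := fun b : RR => (b + y - y, b + y)%R)) nQ; mreal.
- by rewrite lee_fin.
by apply: eq_integral => b _; rewrite /F /= addrK addrC muleCA.
Qed.

Lemma int_compose (k1 k2 : RR -> R) (g : RR -> \bar R) b :
  measurable_fun [set: RR] k1 -> (forall x, 0 <= k1 x)%R ->
  measurable_fun [set: RR] k2 -> (forall x, 0 <= k2 x)%R -> nnm g ->
  \int[leb]_c ((k1 (c - b)%R)%:E * \int[leb]_x ((k2 (x - c)%R)%:E * g x)) =
  \int[leb]_x (g x * \int[leb]_c (k1 (c - b) * k2 (x - c))%:E).
Proof.
move=> mk1 k10 mk2 k20 ng.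
have n1 : nnm (fun c : RR => (k1 (c - b)%R)%:E).
  by apply: nnm_EFin => //; exact: measurable_subc.
pose F (p : RR * RR) := (k1 (p.1 - b)%R)%:E * ((k2 (p.2 - p.1)%R)%:E * g p.2).
have nF : nnm F.
  apply: nnmM; first exact: (nnm_fst n1).
  apply: nnmM; last exact: nnm_snd.
  by apply: nnm_EFin => //; apply: (measurableT_comp mk2); mreal.
transitivity (\int[leb]_c \int[leb]_x F (c, x)).
  apply: eq_integral => c _; rewrite -intZ ?lee_fin//.
  by apply: nnmM => //; apply: nnm_EFin => //; exact: measurable_subc.
rewrite int_swap//; apply: eq_integral => x _; rewrite -intZ; last 2 first.
- apply: nnm_EFin => [|c]; last exact: mulr_ge0.
  by apply: measurable_funM; [exact: measurable_subc|apply: (measurableT_comp mk2); mreal].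
- exact: ng.2.
by apply: eq_integral => c _; rewrite /F /= muleA -EFinM muleC.
Qed.

End pinned_partition.

(** * Overlaps by Cauchy-Schwarz on cells *)

(** Halves of lengths [n] and [n + q] are glued with three further heights; the values 2 and 3 of
    [q] produce the offsets 5 and 6. *)
Lemma halve_large (n0 N : nat) : (n0 + n0 + 6 <= N)%N ->
  exists2 n, (n0 <= n)%N & N = (n + n + 5)%N \/ N = (n + n + 6)%N.
Proof.
move=> nN; exists (uphalf N - 3)%N; first lia.
by have := odd_double_half N; case: (odd N) (uphalf_half N) => -> ; rewrite -addnn; lia.
Qed.

Section overlap.
Context (R : realType).
Local Notation leb := (@lebesgue_measure R).
Local Notation RR := (measurableTypeR R).

Definition cell (a t : R) (i : nat) (x : R) : R := (a + i%:R * t <= x < a + i.+1%:R * t)%R%:R.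

Lemma measurable_cell a t i : measurable_fun [set: RR] (cell a t i : RR -> R).
Proof.
apply: measurable_bool; apply: measurable_and.
  by apply: measurable_fun_ler; mreal.
by apply: measurable_fun_ltr; mreal.
Qed.

Lemma sum_cell a t M x : 0 < t ->
  \sum_(i < M) cell a t i x = (a <= x < a + M%:R * t)%R%:R.
Proof.
move=> t0; elim: M => [|M IH].
  by rewrite big_ord0 mul0r addr0; case: (leP a x) => //= ax; rewrite ltNge ax.
rewrite big_ord_recr /= IH /cell -[M.+1%:R]natr1 mulrDl mul1r.
have Mt : 0 <= M%:R * t by rewrite mulr_ge0// ltW.
move: (M%:R * t) Mt => y y0.
have [ax|ax] := leP a x; have [xy|xy] := ltP x (a + y);
  have [xt|xt] := ltP x (a + (y + t)) => //=; rewrite ?addr0 ?add0r //.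
all: exfalso; lra.
Qed.

(** Sum of the tangent-line bounds of the square at [s = L / M]. *)
Lemma sqr_sum_ge (M : nat) (x : 'I_M -> R) (L : R) : (0 < M)%N -> 0 <= L ->
  L <= \sum_i x i -> L ^+ 2 / M%:R <= \sum_i x i * x i.
Proof.
move=> M0 L0 Lx; have M0R : 0 < M%:R :> R by rewrite ltr0n.
pose s := L / M%:R; have s0 : 0 <= s by rewrite divr_ge0// ltW.
have : \sum_(i < M) (2 * s * x i - s * s) <= \sum_i x i * x i.
  by apply: ler_sum => i _; have := sqr_ge0 (x i - s); rewrite expr2; lra.
apply: le_trans; rewrite big_split/= -mulr_sumr sumr_const card_ord.
have sM : s * M%:R = L by rewrite /s divfK// gt_eqF.
have -> : - (s * s) *+ M = - (s * L) by rewrite -mulr_natr -sM; ring.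
have -> : L ^+ 2 / M%:R = s * L by rewrite /s expr2; ring.
have : s * L <= s * \sum_i x i by rewrite ler_wpM2l.
lra.
Qed.

Local Open Scope ereal_scope.

Definition smooth (r : R) (g : R -> \bar R) (b : R) := \int[leb]_x ((ind r (x - b))%:E * g x).

(** Let [X i] be the mass of [f] in the i-th cell of length [t]. Two points of a cell are within
    [t], so [G >= k * X i] on that cell and the overlap is at least [k] times the sum of the squares
    of the [X i]. The cells cover [[-A, A]], so these masses add up to at least [L]. *)
Lemma overlap_ge (f G : RR -> \bar R) (A t k L : R) (M : nat) :
  nnm f -> nnm G -> (0 < t)%R -> (0 < k)%R -> (0 <= L)%R -> (0 < M)%N ->
  (2 * A < M%:R * t)%R -> \int[leb]_x f x < +oo ->
  L%:E <= \int[leb]_x ((ind A x)%:E * f x) ->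
  (forall b, k%:E * smooth t f b <= G b) ->
  (k * (L ^+ 2 / M%:R))%:E <= \int[leb]_x (f x * G x).
Proof.
move=> nf nG t0 k0 L0 M0 AM ffin Lf fG.
pose a := (- A)%R.
have c0 i x : (0 <= cell a t i x)%R by rewrite /cell.
have nc i : nnm (fun x : RR => (cell a t i x)%:E) by apply: nnm_EFin => //; exact: measurable_cell.
pose X (i : 'I_M) := fine (\int[leb]_x ((cell a t i x)%:E * f x)).
have XE (i : 'I_M) : \int[leb]_x ((cell a t i x)%:E * f x) = (X i)%:E.
  rewrite fineK// ge0_fin_numE; last by apply: integral_ge0 => x _; apply: (nnmM (nc i) nf).2.
  apply: le_lt_trans ffin; apply: int_le => //; first exact: nnmM.
  move=> x; rewrite -[leRHS]mul1e lee_wpmul2r//; first exact: nf.2.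
  by rewrite lee_fin /cell lern1; case: (_ && _).
have X0 i : (0 <= X i)%R.
  by rewrite -lee_fin -XE; apply: integral_ge0 => x _; apply: (nnmM (nc i) nf).2.
have Xsm (i : 'I_M) b : cell a t i b = 1%R -> (X i)%:E <= smooth t f b.
  move=> cb; have [b1 b2] : (a + i%:R * t <= b /\ b < a + i.+1%:R * t)%R.
    by move: cb; rewrite /cell; case: andP => // _ /eqP; rewrite eq_sym oner_eq0.
  rewrite -XE; apply: int_le => [||x].
  - exact: nnmM.
  - apply: nnmM => //; apply: nnm_EFin => [|x]; last exact: ind_ge0.
    exact: (measurable_subc b (measurable_ind t)).
  rewrite lee_wpmul2r//; first exact: nf.2.
  rewrite lee_fin /ind /cell; case: andP => [[x1 x2]|_]; last by rewrite ler0n.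
  rewrite (_ : `|x - b| <= t)%R//.
  by move: b1 b2 x1 x2; rewrite -[i.+1%:R]natr1 ler_norml !mulrDl mul1r; lra.
have sumX : (L <= \sum_i X i)%R.
  rewrite -lee_fin; apply: le_trans Lf _.
  rewrite -sumEFin; under [leRHS]eq_bigr do rewrite -XE.
  rewrite -ge0_integral_sum//; last 2 first.
  - by move=> i; apply: (nnmM (nc i) nf).1.
  - by move=> i x _; apply: (nnmM (nc i) nf).2.
  have nS : nnm (fun x : RR => \sum_(i < M) (cell a t i x)%:E * f x).
    split=> [|x]; last by apply: sume_ge0 => i _; apply: (nnmM (nc i) nf).2.
    by apply: emeasurable_sum => i _; apply: (nnmM (nc i) nf).1.
  apply: int_le => [||x] //; first by apply: nnmM => //; exact: nnm_ind.
  rewrite -ge0_sume_distrl; last by move=> i _; rewrite lee_fin.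
  rewrite lee_wpmul2r//; first exact: nf.2.
  rewrite sumEFin lee_fin sum_cell// /ind; case: (leP `|x|%R A) => [xA|_]; last by rewrite ler0n.
  rewrite (_ : (a <= x < _) = true)%R//.
  by move: xA; rewrite ler_norml /a => /andP[x1 x2]; apply/andP; split; lra.
have := sqr_sum_ge M0 L0 sumX; rewrite -(ler_pM2l k0) -lee_fin => /le_trans; apply.
rewrite mulr_sumr -sumEFin.
have -> : \sum_(i < M) (k * (X i * X i))%:E =
    \int[leb]_x \sum_(i < M) ((k * X i)%:E * ((cell a t i x)%:E * f x)).
  rewrite ge0_integral_sum//; last 2 first.
  - by move=> i; apply: (nnmM (@nnm_cst R _ _ (k * X i)%R (mulr_ge0 (ltW k0) (X0 i))) (nnmM (nc i) nf)).1.
  - by move=> i x _; rewrite mule_ge0// ?lee_fin ?mulr_ge0 ?(ltW k0)//; apply: (nnmM (nc i) nf).2.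
  apply: eq_bigr => i _; rewrite intZ; [|exact: nnmM|by rewrite lee_fin mulr_ge0// ltW].
  by rewrite XE -EFinM mulrA.
apply: int_le => [||x].
- split=> [|x].
    apply: emeasurable_sum => i _.
    by apply: (nnmM (@nnm_cst R _ _ (k * X i)%R (mulr_ge0 (ltW k0) (X0 i))) (nnmM (nc i) nf)).1.
  by apply: sume_ge0 => i _; rewrite mule_ge0// ?lee_fin ?mulr_ge0 ?(ltW k0)//; apply: (nnmM (nc i) nf).2.
- exact: nnmM.
have fGx0 : 0 <= f x * G x by apply: (nnmM nf nG).2.
apply: (@le_trans _ _ (\sum_(i < M) (cell a t i x)%:E * (f x * G x))).
  apply: lee_sum => i _.
  have [ci|ci] : cell a t i x = 1%R \/ cell a t i x = 0%R.
    by rewrite /cell; case: (_ && _); [left|right].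
  - rewrite ci !mul1e muleC lee_wpmul2l//; first exact: nf.2.
    rewrite EFinM; apply: le_trans (fG x); rewrite lee_wpmul2l ?lee_fin ?(ltW k0)//.
    exact: Xsm.
  - by rewrite ci !mul0e mule0.
rewrite -ge0_sume_distrl; last by move=> i _; rewrite lee_fin.
rewrite sumEFin sum_cell// -[leRHS]mul1e lee_wpmul2r// lee_fin lern1.
by case: (_ && _).
Qed.

End overlap.

(** * Lower bound for the unpinned partition function *)

Section free_partition.
Context (R : realType) (e1 h : R -> R) (d c0 Ch C1 H H1 : R).
Local Notation leb := (@lebesgue_measure R).
Local Notation RR := (measurableTypeR R).
Hypotheses (me : measurable_fun [set: RR] (e1 : RR -> R)) (e_gt0 : forall x, 0 < e1 x).
Hypotheses (e_even : forall x, e1 (- x) = e1 x).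
Hypotheses (eC1 : forall x, e1 x <= C1)
  (e_decay : forall k : R, 0 < k -> exists L : R, forall x, L <= `|x| -> e1 x <= k).
Hypotheses (mh : measurable_fun [set: RR] (h : RR -> R)) (h0 : forall x, 0 <= h x).
Hypotheses (hCh : forall x, h x <= Ch) (hH : (\int[leb]_x (h x)%:E <= H%:E)%E)
  (hH1 : (\int[leb]_x (`|x| * h x)%:E <= H1%:E)%E).
Hypotheses (d_gt0 : 0 < d) (c0_gt0 : 0 < c0)
  (hc : forall x, `|x| <= 2 * d -> c0 <= h x).
Local Open Scope ereal_scope.
Local Notation T := (transfer e1 h).
Local Notation J := (fun y : RR => (ind d y)%:E).
Local Notation one := (fun _ : RR => 1%:E : \bar R).
Local Notation psi := (fun x : RR => (`|x|%R)%:E).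
Local Notation P := (pinZ e1 h 0).
Local Notation sw := (stepw e1 h).
Implicit Types f g : RR -> \bar R.

Let e_ge0 x : (0 <= e1 x)%R. Proof. exact: ltW. Qed.
Let nJ : nnm J. Proof. exact: nnm_ind. Qed.
Let n1 : nnm one. Proof. exact: nnm_cst. Qed.
Let npsi : nnm psi. Proof. by apply: nnm_EFin => // ; mreal. Qed.
Let nT f : nnm f -> nnm (T f : RR -> \bar R). Proof. exact: nnm_transfer. Qed.
Let nTn n f : nnm f -> nnm (iter n T f : RR -> \bar R). Proof. exact: nnm_iter. Qed.
Let nh : nnm (fun y : RR => (h y)%:E).
Proof. exact: nnm_EFin. Qed.
Let C1_ge0 : (0 <= C1)%R. Proof. exact: le_trans (e_ge0 0) (eC1 0). Qed.
Let Ch_ge0 : (0 <= Ch)%R. Proof. exact: le_trans (h0 0) (hCh 0). Qed.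
Let nP n d' (X : measurableType d') (u v : X -> R) :
  measurable_fun [set: X] u -> measurable_fun [set: X] v ->
  nnm (fun x => P n (u x) (v x)).
Proof. exact: nnm_pinZ2. Qed.
Let H_ge0 : (0 <= H)%R.
Proof.
by rewrite -lee_fin; apply: le_trans hH; apply: integral_ge0 => x _; rewrite lee_fin.
Qed.
Let H1_ge0 : (0 <= H1)%R.
Proof.
by rewrite -lee_fin; apply: le_trans hH1; apply: integral_ge0 => x _; rewrite lee_fin mulr_ge0.
Qed.
Let P0 n a b : 0 <= P n a b.
Proof. exact: (nnm_pinZ me e_gt0 mh h0 n (lexx 0%R)).2 (a, b). Qed.

Lemma stepwE b x c : sw (b - x) b c = (h (c - b - x) * e1 (c - b))%R.
Proof. by rewrite /stepw mulrC; congr (h _ * _)%R; ring. Qed.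

Lemma P_succ_int n b x : P n.+1 (b - x)%R b =
  \int[leb]_c ((h (c - b - x) * e1 (c - b))%R%:E * P n b c).
Proof. by rewrite pinZ0S; apply: eq_integral => c _; rewrite stepwE. Qed.

(** In terms of the initial increment [x], the final zeros enter only through the weights of the
    last two steps, each at most [C1 * Ch]; enlarging these to constants leaves the increment chain
    with a free end. *)
Lemma P_le n b x :
  P n (b - x)%R b <= (C1 * Ch * C1 * Ch)%:E * iter n T one x.
Proof.
elim: n b x => [|n IH] b x.
  rewrite mule1 /= lee_fin /stepw -[leRHS]mulrA.
  by apply: ler_pM; rewrite ?mulr_ge0//; apply: ler_pM.
have nG : nnm (fun c : RR => (h (c - b - x) * e1 (c - b))%R%:E * P n b c).
  apply: nnmM; last by apply: nP; mreal.
  apply: nnm_EFin => [|y]; last exact: mulr_ge0.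
  apply: measurable_funM; [apply: (measurableT_comp mh)|apply: (measurableT_comp me)]; mreal.
rewrite P_succ_int -(int_shift b nG) /= -transferZ//; last 2 first.
- exact: nTn.
- by rewrite lee_fin !mulr_ge0.
apply: int_le => [||y].
- by apply: nnm_comp nG; mreal.
- apply: nnm_kernelM => //; apply: nnmM; last exact: nTn.
  by apply: nnm_cst; rewrite !mulr_ge0.
rewrite addrK lee_wpmul2l ?lee_fin ?mulr_ge0//.
by have := IH (y + b)%R y; rewrite (addrC y) addrK.
Qed.

(** The initial increment [x] is fixed and the initial height integrated out. By translation this
    frees the height constraint, so that for [theta = one] the recursion is that of the increment
    chain. *)
Definition moment (theta : R -> \bar R) n x := \int[leb]_b (theta b * P n (b - x)%R b).

Lemma nnm_moment theta n : nnm (theta : RR -> \bar R) -> nnm (moment theta n : RR -> \bar R).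
Proof.
move=> nt; apply: (@nnm_int _ _ _ leb (fun p : RR * RR => theta p.2 * P n (p.2 - p.1)%R p.2)).
by apply: nnmM; [exact: nnm_snd|apply: nP; mreal].
Qed.

Lemma momentS theta n x : nnm (theta : RR -> \bar R) ->
  moment theta n.+1 x =
  \int[leb]_y ((h (y - x) * e1 y)%:E * \int[leb]_b (theta (b - y)%R * P n (b - y)%R b)).
Proof.
move=> nt.
rewrite -(@int_increment R theta (fun y => h (y - x) * e1 y)%R (fun p => P n p.1 p.2))//.
- by apply: eq_integral => b _; rewrite P_succ_int.
- by apply: measurable_funM => //; exact: measurable_subc.
- by move=> y; rewrite mulr_ge0.
- exact: nnm_pinZ.
Qed.

Lemma momentS_one n x : moment one n.+1 x = T (moment one n) x.
Proof. by rewrite momentS. Qed.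

Lemma nnm_shift_moment n : nnm (fun y : RR => \int[leb]_b (psi (b - y)%R * P n (b - y)%R b)).
Proof.
apply: (@nnm_int _ _ _ leb (fun p : RR * RR => psi (p.2 - p.1)%R * P n (p.2 - p.1)%R p.2)).
by apply: nnmM; [apply: nnm_EFin => //; mreal|apply: nP; mreal].
Qed.

Lemma shift_moment_le n y : \int[leb]_b (psi (b - y)%R * P n (b - y)%R b) <=
  moment psi n y + psi y * moment one n y.
Proof.
have nPy : nnm (fun b : RR => P n (b - y)%R b) by apply: nP; mreal.
rewrite /moment -intZ; last 2 first.
- exact: (nnmM n1 nPy).
- by rewrite lee_fin.
rewrite -intD; last 2 first.
- exact: (nnmM npsi nPy).
- by apply: nnmM; [exact: nnm_cst|exact: (nnmM n1 nPy)].
apply: int_le => [||b].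
- by apply: nnmM => //; apply: nnm_EFin => //; mreal.
- apply: nnmD; first exact: (nnmM npsi nPy).
  by apply: nnmM; [exact: nnm_cst|exact: (nnmM n1 nPy)].
rewrite mul1e -ge0_muleDl ?lee_fin// lee_wpmul2r//.
by rewrite -EFinD lee_fin ler_normB.
Qed.

Let nm n t : nnm t -> nnm (moment t n : RR -> \bar R).
Proof. exact: nnm_moment. Qed.

(** The substitution of [int_increment] shifts the height by the next increment [y], hence the
    additional term with [|y|]. *)
Lemma momentS_psi n x : moment psi n.+1 x <=
  T (fun y => moment psi n y + psi y * moment one n y) x.
Proof.
rewrite momentS//; apply: int_le => [||y].
- by apply: nnm_kernelM => //; exact: nnm_shift_moment.
- apply: nnm_kernelM => //; apply: nnmD; first exact: nm.
  by apply: nnmM; [exact: npsi|exact: nm].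
by rewrite lee_wpmul2l ?lee_fin ?mulr_ge0//; exact: shift_moment_le.
Qed.

Lemma stepw_b00 b : sw b 0 0 = (e1 0 * h b)%R.
Proof. by rewrite /stepw; congr (e1 _ * h _)%R; ring. Qed.

Lemma P0_le b x : P 0 (b - x)%R b <= (C1 * Ch * C1)%:E * (h b)%:E.
Proof.
rewrite /= -EFinM lee_fin stepwE stepw_b00 mulrA ler_wpM2r// (mulrC C1).
by apply: ler_pM; rewrite ?mulr_ge0//; apply: ler_pM.
Qed.

Lemma P0_ge (b x : R) : (c0 * c0 * e1 0)%:E * (J x * ((e1 b)%:E * (J b * J b))) <= P 0 (b - x)%R b.
Proof.
rewrite /ind; have [xd|_] := boolP (`|x| <= d)%R; last by rewrite mul0e mule0.
have [bd|_] := boolP (`|b| <= d)%R; last by rewrite mul0e !mule0.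
rewrite !mule1 mul1e -EFinM /= lee_fin stepwE stepw_b00 sub0r e_even.
rewrite (_ : c0 * c0 * e1 0 * e1 b = (c0 * e1 b) * (e1 0 * c0))%R; last by ring.
apply: ler_pM; rewrite ?mulr_ge0 ?(ltW c0_gt0)//.
  rewrite ler_wpM2r// hc// -opprD normrN (le_trans (ler_normD _ _))//; lra.
by rewrite ler_wpM2l// hc// (le_trans bd)// ler_peMl ?ler1n ?(ltW d_gt0).
Qed.

Lemma moment_one_le n x : moment one n x <= (C1 * Ch * C1 * H)%:E * iter n T one x.
Proof.
have K0 : 0 <= (C1 * Ch * C1 * H)%:E by rewrite lee_fin !mulr_ge0.
elim: n x => [|n IH] x.
  rewrite mule1 EFinM; apply: le_trans (lee_wpmul2l _ hH); last by rewrite lee_fin !mulr_ge0.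
  rewrite -intZ//; last by rewrite lee_fin !mulr_ge0.
  apply: int_le => [||b].
  - by apply: nnmM => //; apply: nP; mreal.
  - by apply: nnmM => //; apply: nnm_cst; rewrite !mulr_ge0.
  - by rewrite mul1e; exact: P0_le.
rewrite momentS_one/= -transferZ//; last exact: nTn.
by apply: transfer_le => //; [exact: nm|apply: nnmM; [split => //|exact: nTn]].
Qed.

Lemma moment_psi0_le x : moment psi 0 x <= (C1 * Ch * C1 * H1)%:E.
Proof.
rewrite EFinM; apply: le_trans (lee_wpmul2l _ hH1); last by rewrite lee_fin !mulr_ge0.
have nph : nnm (fun b : RR => (`|b| * h b)%:E).
  by apply: nnm_EFin => [|b]; [mreal|exact: mulr_ge0].
rewrite -intZ//; last by rewrite lee_fin !mulr_ge0.
apply: int_le => [||b].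
- by apply: nnmM => //; apply: nP; mreal.
- by apply: nnmM => //; apply: nnm_cst; rewrite !mulr_ge0.
- by rewrite (EFinM `|b|%R) muleCA lee_wpmul2l ?lee_fin//; exact: P0_le.
Qed.

Lemma moment_one_ge n x :
  (c0 * c0 * e1 0)%:E * dot e1 J J * iter n T J x <= moment one n x.
Proof.
have K0 : 0 <= (c0 * c0 * e1 0)%:E by rewrite lee_fin !mulr_ge0 ?(ltW c0_gt0).
have D0 : 0 <= dot e1 J J by exact: dot_ge0.
have KD0 := mule_ge0 K0 D0.
elim: n x => [|n IH] x.
  rewrite /= -muleA (muleC _ (J x)) /dot -intZ; [|exact: nnm_dot|by rewrite lee_fin ind_ge0].
  have nD : nnm (fun b : RR => J x * ((e1 b)%:E * (J b * J b))).
    by apply: nnmM; [apply: nnm_cst; exact: ind_ge0|exact: nnm_dot].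
  rewrite -intZ//; apply: int_le => [||b].
  - by apply: nnmM => //; split.
  - by apply: nnmM => //; apply: nP; mreal.
  - by rewrite mul1e; exact: P0_ge.
rewrite momentS_one/= -transferZ//; last exact: nTn.
by apply: transfer_le => //; [apply: nnmM; [split => //|exact: nTn]|exact: nm].
Qed.

(* Mass of the paths leaving height [b] with an increment in [-d, d]: consecutive
   flat increments differ by at most [2 d], where [h] is bounded below, so that
   such paths can be glued. *)
Definition flat_mass n b := \int[leb]_c ((ind d (c - b) * e1 (c - b))%:E * P n b c).

Let mkap : measurable_fun [set: RR] (fun u : RR => (ind d u * e1 u)%R).
Proof. by apply: measurable_funM => //; exact: measurable_ind. Qed.
Let kap0 u : (0 <= ind d u * e1 u)%R.
Proof. by rewrite mulr_ge0 ?ind_ge0. Qed.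

Lemma nnm_flat n : nnm (flat_mass n : RR -> \bar R).
Proof.
apply: (@nnm_int _ _ _ leb (fun p : RR * RR => (ind d (p.2 - p.1) * e1 (p.2 - p.1))%:E * P n p.1 p.2)).
apply: nnmM; last by apply: nP; mreal.
by apply: nnm_EFin => //; apply: (measurableT_comp mkap); mreal.
Qed.

Lemma int_flat (theta : RR -> \bar R) n : nnm theta ->
  \int[leb]_b (theta b * flat_mass n b) =
  \int[leb]_y ((ind d y * e1 y)%:E * \int[leb]_b (theta (b - y)%R * P n (b - y)%R b)).
Proof.
move=> nt.
rewrite -(@int_increment R theta (fun y => ind d y * e1 y)%R (fun p => P n p.1 p.2))//.
exact: nnm_pinZ.
Qed.

Lemma int_flat_one n : \int[leb]_b flat_mass n b = dot e1 J (moment one n).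
Proof.
transitivity (\int[leb]_b (one b * flat_mass n b)).
  by apply: eq_integral => b _; rewrite mul1e.
rewrite int_flat//; apply: eq_integral => y _.
by rewrite EFinM -muleA muleCA.
Qed.

(** * Cutting a path at an inner height and gluing two halves *)

Section reversal.
Variables n m : nat.

Let G (p : (RR * RR) * RR) := (e1 (p.1.1 - p.1.2))%:E * P m p.1.2 p.1.1 *
  ((e1 (p.2 - p.1.2))%:E * P n p.1.2 p.2 * (h (p.2 + p.1.1 - 2 * p.1.2))%:E).

Let nG : nnm G.
Proof.
have ne (u : (RR * RR) * RR -> R) : measurable_fun [set: (RR * RR) * RR] u -> nnm (fun p => (e1 (u p))%:E).
  by move=> mu; apply: nnm_EFin => //; exact: (measurableT_comp me).
apply: nnmM; first by apply: nnmM; [apply: ne; mreal|apply: nP; mreal].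
apply: nnmM; first by apply: nnmM; [apply: ne; mreal|apply: nP; mreal].
by apply: nnm_EFin => //; apply: (measurableT_comp mh); mreal.
Qed.

(* A path from [0, 0] to [0, 0] is cut at an inner height [b] (site) or at an inner
   pair [a, b] (bond); since [e1] is even, the reversed left half is again a path
   ending at [0, 0], so that both halves are described by the same weights [P]. *)
Definition site_overlap := \int[leb]_b \int[leb]_a \int[leb]_c G ((a, b), c).

Definition bond_overlap k j := \int[leb]_a \int[leb]_b (P j b a * ((e1 (b - a)%R)%:E * P k a b)).

Let nstep a b k : nnm (fun c : RR => (sw a b c)%:E * P k b c).
Proof. by apply: nnmM; [apply: nnm_stepw => //; mreal|apply: nP; mreal]. Qed.

Let nGc (u v w : RR -> RR) : measurable_fun [set: RR] u -> measurable_fun [set: RR] v ->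
  measurable_fun [set: RR] w -> nnm (fun x : RR => G ((u x, v x), w x)).
Proof.
move=> mu mv mw; apply: (nnm_comp (g := fun x : RR => ((u x, v x), w x))) nG.
by apply: measurable_fun_pair => //; exact: measurable_fun_pair.
Qed.

(** Expanding the first step of either half of a bond overlap gives the same triple integral, so
    free heights can be moved from the left half to the right one. *)
Lemma bond_overlapSl : bond_overlap n.+1 m = site_overlap.
Proof.
rewrite /site_overlap (int_swap (f := fun p : RR * RR => \int[leb]_c G ((p.2, p.1), c))); last first.
  apply: (@nnm_int _ _ _ leb (fun p : (RR * RR) * RR => G ((p.1.2, p.1.1), p.2))).
  apply: (nnm_comp (g := fun p : (RR * RR) * RR => ((p.1.2, p.1.1), p.2))) nG.
  by apply: measurable_fun_pair; mreal.
apply: eq_integral => a _; apply: eq_integral => b _.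
rewrite pinZ0S muleA -intZ//; last by rewrite mule_ge0// lee_fin.
apply: eq_integral => c _; rewrite /G /stepw /= -opprB e_even EFinM.
by rewrite (muleC (P m b a)) -!muleA; congr (_ * (_ * (_ * _))); rewrite muleC.
Qed.

Lemma bond_overlapSr : bond_overlap n m.+1 = site_overlap.
Proof.
apply: eq_integral => b _.
rewrite (int_swap (f := fun p : RR * RR => G ((p.1, b), p.2))); last first.
  apply: (nnm_comp (g := fun p : RR * RR => ((p.1, b), p.2))) nG.
  by apply: measurable_fun_pair; mreal.
apply: eq_integral => c _.
rewrite pinZ0S -intZr//; last by rewrite mule_ge0// lee_fin.
apply: eq_integral => a _; rewrite /G /stepw /= EFinM.
by rewrite -!muleA; congr (_ * _); rewrite muleC -!muleA (addrC a).
Qed.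

Lemma site_overlap_ge : c0%:E * \int[leb]_b (flat_mass m b * flat_mass n b) <= site_overlap.
Proof.
have nk j b : nnm (fun c : RR => (ind d (c - b) * e1 (c - b))%:E * P j b c).
  apply: nnmM; last by apply: nP; mreal.
  by apply: nnm_EFin => //; exact: (measurable_subc b mkap).
have nm' j : nnm (fun b : RR => flat_mass j b) by exact: nnm_flat.
have nab : nnm (fun p : RR * RR => \int[leb]_c G ((p.2, p.1), c)).
  apply: (@nnm_int _ _ _ leb (fun p : (RR * RR) * RR => G ((p.1.2, p.1.1), p.2))).
  apply: (nnm_comp (g := fun p : (RR * RR) * RR => ((p.1.2, p.1.1), p.2))) nG.
  by apply: measurable_fun_pair; mreal.
rewrite -intZ; [|exact: (nnmM (nm' m) (nm' n))|by rewrite lee_fin ltW].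
apply: int_le => [||b].
- by apply: nnmM; [apply: nnm_cst; exact: ltW|exact: (nnmM (nm' m) (nm' n))].
- exact: (@nnm_int _ _ _ leb (fun p : RR * RR => \int[leb]_c G ((p.2, p.1), c))).
rewrite muleCA {1}/flat_mass -intZr; [|exact: nk|]; last first.
  by rewrite mule_ge0// ?lee_fin ?(ltW c0_gt0)//; exact: (nm' n).2.
apply: int_le => [||a].
- apply: nnmM; first exact: nk.
  by split => // x; rewrite mule_ge0// ?lee_fin ?(ltW c0_gt0)//; exact: (nm' n).2.
- apply: (@nnm_int _ _ _ leb (fun p : RR * RR => G ((p.1, b), p.2))).
  apply: (nnm_comp (g := fun p : RR * RR => ((p.1, b), p.2))) nG.
  by apply: measurable_fun_pair; mreal.
rewrite muleCA /flat_mass -intZ; [|exact: nk|exact: (nk m b).2].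
rewrite -intZ; last 2 first.
- by apply: nnmM; [split => // x; exact: (nk m b).2|exact: nk].
- by rewrite lee_fin ltW.
apply: int_le => [||c].
- apply: nnmM; first by apply: nnm_cst; exact: ltW.
  by apply: nnmM; [split => // x; exact: (nk m b).2|exact: nk].
- by apply: nGc; mreal.
rewrite /G /ind /=; have [ab|_] := boolP (`|a - b| <= d)%R; last first.
  by rewrite mul0r !mul0e mule0 !mule_ge0 ?lee_fin.
have [cb|_] := boolP (`|c - b| <= d)%R; last first.
  by rewrite mul0r mul0e !mule0 !mule_ge0 ?lee_fin.
rewrite !mul1r muleC -!muleA; do 4 (apply: lee_wpmul2l; rewrite ?lee_fin//).
apply: hc; rewrite (_ : c + a - 2 * b = (c - b) + (a - b))%R; last by ring.
by rewrite (le_trans (ler_normD _ _))// mulr2n mulrDl mul1r lerD.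
Qed.

End reversal.

(** The factor [e1 0] is the bond between the two zeros on the left: the reversed half charges it at
    its end, while [P] does not charge the bond between its initial heights. *)
Lemma bond_overlapE n m : bond_overlap n m = (e1 0)%:E * P (n + m).+2 0 0.
Proof.
elim: m n => [|m IH] n; last by rewrite bond_overlapSr -bond_overlapSl IH addSnnS.
rewrite addn0 pinZ0S -intZ ?lee_fin//; last first.
  by apply: nnmM; [apply: nnm_stepw => //; mreal|apply: nP; mreal].
apply: eq_integral => a _; rewrite pinZ0S muleA -intZ; last 2 first.
- by apply: nnmM; [apply: nnm_stepw => //; mreal|apply: nP; mreal].
- by rewrite -EFinM lee_fin mulr_ge0// stepw_ge0.
apply: eq_integral => b _; rewrite /= !muleA -!EFinM; congr (_%:E * _).
by rewrite /stepw !mulr0 !add0r !addr0 !subr0 !e_even; ring.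
Qed.

Lemma site_overlapE n m : site_overlap n m = (e1 0)%:E * P (n + m).+3 0 0.
Proof. by rewrite -bond_overlapSl bond_overlapE addSn. Qed.

Lemma flatS_ge n b :
  c0%:E * \int[leb]_c ((ind d (c - b) * e1 (c - b))%:E * flat_mass n c) <= flat_mass n.+1 b.
Proof.
have nk b' : nnm (fun c : RR => (ind d (c - b') * e1 (c - b'))%:E).
  by apply: nnm_EFin => //; exact: (measurable_subc b' mkap).
have nn : nnm (flat_mass n : RR -> \bar R) by exact: nnm_flat.
have nkn := nnmM (nk b) nn.
rewrite -intZ//; last by rewrite lee_fin ltW.
apply: int_le => [||c].
- by apply: nnmM => //; apply: nnm_cst; exact: ltW.
- by apply: nnmM; [exact: nk|apply: nP; mreal].
rewrite muleCA /ind; have [cb|_] := boolP (`|c - b| <= d)%R; last by rewrite mul0r !mul0e.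
rewrite mul1r lee_wpmul2l ?lee_fin// pinZ0S /flat_mass.
have nPc : nnm (fun x : RR => P n c x) by apply: nP; mreal.
have nkP := nnmM (nk c) nPc.
rewrite -intZ//; last by rewrite lee_fin ltW.
apply: int_le => [||x].
- by apply: nnmM => //; apply: nnm_cst; exact: ltW.
- by apply: nnmM => //; apply: nnm_stepw => //; mreal.
rewrite muleA lee_wpmul2r// -EFinM lee_fin /ind /stepw.
have [xc|_] := boolP (`|x - c| <= d)%R; last by rewrite mul0r mulr0 mulr_ge0.
rewrite mul1r mulrC ler_wpM2l// hc//.
rewrite (_ : x + b - 2 * c = (x - c) - (c - b))%R; last by ring.
by rewrite (le_trans (ler_normB _ _))// mulr2n mulrDl mul1r lerD.
Qed.

(** * Smoothing of the flat mass by two or three flat steps *)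

Let nind r b : nnm (fun x : RR => (ind r (x - b))%:E).
Proof.
by apply: nnm_EFin => [|x]; [exact: (measurable_subc b (measurable_ind r))|exact: ind_ge0].
Qed.

(* A Steinhaus argument: outside a small set [e1] is bounded below on [-d, d], so
   the convolution of two such densities is bounded below near [0]. *)
Lemma step2_density : exists2 k : R, (0 < k)%R & forall b x : R, (`|x - b| <= d / 2)%R ->
  k%:E <= \int[leb]_c (ind d (c - b) * e1 (c - b) * (ind d (x - c) * e1 (x - c)))%:E.
Proof.
have d40 : (0 < d / 4)%R by rewrite divr_gt0.
(* The two exceptional sets, around [b] and around [x], remove at most [d / 4] each from a window of
   length [d]; a length [d / 2] remains on which both densities are at least [k]. *)
have [k k0 small] := low_small me e_gt0 d d40.
exists (k * k * (d / 2))%R; first by rewrite !mulr_gt0// divr_gt0.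
move=> b x xb; set I := \int[leb]_c _.
have mlow : measurable_fun [set: RR] (low e1 d k : RR -> R) by exact: measurable_low.
have low0 u : (0 <= low e1 d k u)%R by rewrite /low.
have kk0 : (0 <= k * k)%R by rewrite mulr_ge0 ?ltW.
have nl y : nnm (fun c : RR => (low e1 d k (c - y))%:E).
  by apply: nnm_EFin => //; exact: measurable_subc.
have small2 y : \int[leb]_c (low e1 d k (c - y))%:E <= (d / 4)%:E.
  by rewrite (@int_shift R (fun c => (low e1 d k c)%:E) (- y)%R)//; exact: nnm_EFin.
have nI : nnm (fun c : RR => (ind d (c - b) * e1 (c - b) * (ind d (x - c) * e1 (x - c)))%:E).
  apply: nnm_EFin => [|c]; last exact: mulr_ge0.
  by apply: measurable_funM; [exact: (measurable_subc b mkap)|apply: (measurableT_comp mkap); mreal].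
have nW : nnm (fun c : RR => (((b - d / 2 <= c <= b + d / 2)%R)%R%:R : R)%:E).
  by apply: nnm_EFin => //; exact: measurable_itvb.
have nkl y : nnm (fun c : RR => (k * k)%:E * (low e1 d k (c - y))%:E).
  by apply: nnmM => //; exact: nnm_cst.
have : (k * k)%:E * \int[leb]_c (((b - d / 2 <= c <= b + d / 2)%R)%R%:R : R)%:E <=
    I + ((k * k)%:E * \int[leb]_c (low e1 d k (c - b))%:E +
         (k * k)%:E * \int[leb]_c (low e1 d k (c - x))%:E).
  rewrite -!intZ// -intD// -intD//; last exact: nnmD.
  apply: int_le => [||c].
  - by apply: nnmM => //; exact: nnm_cst.
  - by apply: nnmD => //; exact: nnmD.
  rewrite -!EFinM -!EFinD lee_fin.
  have kl0 u : (0 <= k * k * low e1 d k u)%R by rewrite mulr_ge0.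
  have [/andP[c1 c2]|_] := boolP (b - d / 2 <= c <= b + d / 2)%R; last first.
    by rewrite mulr0 !addr_ge0// mulr_ge0.
  have cb : (`|c - b| <= d)%R.
    by have dd := d_gt0; rewrite ler_norml; lra.
  have xc : (`|c - x| <= d)%R.
    rewrite (_ : c - x = (c - b) - (x - b))%R; last by ring.
    rewrite (le_trans (ler_normB _ _))//.
    have : (`|c - b| <= d / 2)%R by rewrite ler_norml; lra.
    by move: xb; lra.
  rewrite /ind /low cb xc (distrC x c) xc !mul1r mulr1 /=.
  rewrite -(opprB c x) e_even.
  have p1 := e_gt0 (c - b)%R; have p2 := e_gt0 (c - x)%R; have pp := mulr_gt0 p1 p2.
  case: (ltP (e1 (c - b)) k) => [_|k1]; case: (ltP (e1 (c - x)) k) => [_|k2];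
    rewrite ?mulr1 ?mulr0 ?addr0 ?add0r; try (move: kk0; lra).
  by apply: ler_pM => //; exact: ltW.
rewrite int_itvb; last by have dd := d_gt0; lra.
rewrite (_ : b + d / 2 - (b - d / 2) = d)%R; last by lra.
move=> H3; rewrite -(@leeD2rE _ (k * k * (d / 2))%:E)// -EFinD.
apply: le_trans (le_trans H3 _).
  by rewrite -EFinM lee_fin; lra.
rewrite leeD2l//; apply: (@le_trans _ _ ((k * k)%:E * (d / 4)%:E + (k * k)%:E * (d / 4)%:E)).
  by apply: leeD; apply: lee_wpmul2l; rewrite ?lee_fin.
by rewrite -!EFinM -EFinD lee_fin; lra.
Qed.

Lemma nnm_smooth r g : nnm g -> nnm (smooth r g : RR -> \bar R).
Proof.
move=> ng; apply: (@nnm_int _ _ _ leb (fun p : RR * RR => (ind r (p.2 - p.1))%:E * g p.2)).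
apply: nnmM; last exact: nnm_snd.
apply: nnm_EFin => [|x]; last exact: ind_ge0.
by apply: (measurableT_comp (measurable_ind r)); mreal.
Qed.

Lemma flat2_ge : exists2 k : R, (0 < k)%R & forall n b,
  k%:E * smooth (d / 2) (flat_mass n) b <= flat_mass n.+2 b.
Proof.
have [k k0 dens] := step2_density.
have nn n : nnm (flat_mass n : RR -> \bar R) by exact: nnm_flat.
have nk b' : nnm (fun c : RR => (ind d (c - b') * e1 (c - b'))%:E).
  by apply: nnm_EFin => //; exact: (measurable_subc b' mkap).
exists (c0 * c0 * k)%R; first by rewrite !mulr_gt0.
move=> n b; apply: le_trans (flatS_ge n.+1 b).
rewrite -!mulrA EFinM -muleA lee_wpmul2l ?lee_fin ?(ltW c0_gt0)//.
have nint : nnm (fun c : RR => \int[leb]_x ((ind d (x - c) * e1 (x - c))%:E * flat_mass n x)).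
  apply: (@nnm_int _ _ _ leb (fun p : RR * RR => (ind d (p.2 - p.1) * e1 (p.2 - p.1))%:E * flat_mass n p.2)).
  apply: nnmM; last exact: nnm_snd.
  by apply: nnm_EFin => //; apply: (measurableT_comp mkap); mreal.
apply: (@le_trans _ _ (\int[leb]_c ((ind d (c - b) * e1 (c - b))%:E *
    (c0%:E * \int[leb]_x ((ind d (x - c) * e1 (x - c))%:E * flat_mass n x))))); last first.
  apply: int_le => [||c].
  - by apply: nnmM => //; apply: nnmM => //; apply: nnm_cst; exact: ltW.
  - exact: nnmM.
  - by rewrite lee_wpmul2l ?lee_fin//; exact: flatS_ge.
under eq_integral do rewrite muleCA.
rewrite intZ; [|exact: nnmM|by rewrite lee_fin ltW].
rewrite EFinM -muleA lee_wpmul2l ?lee_fin ?(ltW c0_gt0)//.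
rewrite (@int_compose R (fun u => ind d u * e1 u)%R (fun u => ind d u * e1 u)%R)//.
rewrite /smooth -intZ; [|by apply: nnmM|by rewrite lee_fin ltW].
apply: int_le => [||x].
- by apply: nnmM; [apply: nnm_cst; exact: ltW|exact: nnmM].
- apply: nnmM => //.
  apply: (@nnm_int _ _ _ leb (fun p : RR * RR =>
    (ind d (p.2 - b) * e1 (p.2 - b) * (ind d (p.1 - p.2) * e1 (p.1 - p.2)))%:E)).
  apply: nnm_EFin => [|p]; last exact: mulr_ge0.
  by apply: measurable_funM; apply: (measurableT_comp mkap); mreal.
rewrite muleA muleC lee_wpmul2l//; first exact: (nn n).2.
rewrite {1}/ind; have [xb|_] := boolP (`|x - b| <= d / 2)%R; last first.
  by rewrite mule0; apply: integral_ge0 => c _; rewrite lee_fin; exact: mulr_ge0.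
by rewrite mule1; exact: dens.
Qed.

(** A third step serves the other parity. One factor of the convolution is now the indicator of
    radius [d / 2], so the mass of [e1] on [[-d / 4, d / 4]] is a sufficient lower bound once the
    radius is reduced to [d / 4]. *)
Lemma flat3_ge : exists2 k : R, (0 < k)%R & forall n b,
  k%:E * smooth (d / 4) (flat_mass n) b <= flat_mass n.+3 b.
Proof.
have [k k0 sm2] := flat2_ge.
have nn n : nnm (flat_mass n : RR -> \bar R) by exact: nnm_flat.
have nk b' : nnm (fun c : RR => (ind d (c - b') * e1 (c - b'))%:E).
  by apply: nnm_EFin => //; exact: (measurable_subc b' mkap).
have d40 : (0 < d / 2)%R by rewrite divr_gt0.
have [q q0 hq] := density_itv me e_gt0 (d / 4) d40.
exists (c0 * (k * q))%R; first by rewrite !mulr_gt0.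
move=> n b; apply: le_trans (flatS_ge n.+2 b).
rewrite EFinM -muleA lee_wpmul2l ?lee_fin ?(ltW c0_gt0)//.
have ns := nnm_smooth (d / 2) (nn n).
apply: (@le_trans _ _ (\int[leb]_c ((ind d (c - b) * e1 (c - b))%:E *
    (k%:E * smooth (d / 2) (flat_mass n) c)))); last first.
  apply: int_le => [||c].
  - by apply: nnmM => //; apply: nnmM => //; apply: nnm_cst; exact: ltW.
  - exact: nnmM.
  - by rewrite lee_wpmul2l ?lee_fin//; exact: sm2.
under eq_integral do rewrite muleCA.
rewrite intZ; [|exact: nnmM|by rewrite lee_fin ltW].
rewrite EFinM -muleA lee_wpmul2l ?lee_fin ?(ltW k0)//.
rewrite (@int_compose R (fun u => ind d u * e1 u)%R (ind (d / 2)))//; last exact: measurable_ind.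
rewrite /smooth -intZ; [|by apply: nnmM|by rewrite lee_fin ltW].
apply: int_le => [||x].
- by apply: nnmM; [apply: nnm_cst; exact: ltW|exact: nnmM].
- apply: nnmM => //.
  apply: (@nnm_int _ _ _ leb (fun p : RR * RR =>
    (ind d (p.2 - b) * e1 (p.2 - b) * ind (d / 2) (p.1 - p.2))%:E)).
  apply: nnm_EFin => [|p]; last by rewrite mulr_ge0// ind_ge0.
  apply: measurable_funM; first by apply: (measurableT_comp mkap); mreal.
  by apply: (measurableT_comp (measurable_ind (d / 2))); mreal.
rewrite muleA muleC lee_wpmul2l//; first exact: (nn n).2.
rewrite {1}/ind; have [xb|_] := boolP (`|x - b| <= d / 4)%R; last first.
  by rewrite mule0; apply: integral_ge0 => c _; rewrite lee_fin; apply: mulr_ge0.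
have nq : nnm (fun c : RR => ((- (d / 4) <= c <= d / 4)%R%:R * e1 c)%:E).
  apply: nnm_EFin => [|c]; last by rewrite mulr_ge0.
  by apply: measurable_funM => //; exact: measurable_itvb.
rewrite mule1; apply: le_trans (hq (- (d / 4))%R (d / 4)%R _ _ _) _ => //.
  by have dd := d_gt0; lra.
rewrite -(int_shift (- b) nq); apply: int_le => [||c].
- by apply: nnm_comp nq; mreal.
- apply: nnm_EFin => [|c]; last by rewrite mulr_ge0// ind_ge0.
  apply: measurable_funM; first exact: (measurable_subc b mkap).
  by apply: (measurableT_comp (measurable_ind (d / 2))); mreal.
rewrite lee_fin -ler_norml /ind; have [cb|_] := boolP (`|c - b| <= d / 4)%R; last first.
  by rewrite mul0r mulr_ge0// mulr_ge0.
have -> : (`|c - b| <= d)%R by apply: le_trans cb _; have dd := d_gt0; lra.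
have -> : (`|x - c| <= d / 2)%R.
  rewrite (_ : x - c = (x - b) - (c - b))%R; last by ring.
  by rewrite (le_trans (ler_normB _ _))//; move: xb cb; lra.
by rewrite !mul1r mulr1.
Qed.

(** * Free weights under two-sided growth bounds for the increment chain *)

Section growth.
Variables (l C c : R) (n0 : nat).
Hypotheses (l_gt0 : (0 < l)%R) (C_gt0 : (0 < C)%R) (c_gt0 : (0 < c)%R).
Hypothesis one_le : forall n x, iter n T one x <= (C * l ^+ n)%:E.
Hypothesis J_ge : forall n, (n0 <= n)%N -> (c * l ^+ n)%:E <= dot e1 J (iter n T J).
Hypothesis psi_le : forall n x, iter n T psi x <= (l ^+ n * (`|x| + C))%:E.

Let K0 : R := (C1 * Ch * C1)%R.
Let K0_ge0 : (0 <= K0)%R. Proof. by rewrite !mulr_ge0. Qed.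
Let ln_ge0 n : (0 <= l ^+ n)%R. Proof. by rewrite exprn_ge0 ?ltW. Qed.
Let C_ge0 : (0 <= C)%R. Proof. exact: ltW. Qed.

Lemma moment_one_lel n x : moment one n x <= (K0 * H * C * l ^+ n)%:E.
Proof.
apply: le_trans (moment_one_le n x) _.
rewrite -(mulrA _ C) [leRHS]EFinM lee_wpmul2l// lee_fin mulr_ge0//.
Qed.

(** The iterate [j] strengthens the induction: lowering [n] by one passes to [j.+1] and leaves one
    term with the size of a single increment, bounded by [psi_le]. Summing [n] such terms gives the
    linear growth. *)
Lemma iter_moment_psi_le n j x : iter j T (moment psi n) x <=
  (l ^+ (n + j) * (K0 * H1 * C + n%:R * (K0 * H * C * (`|x| + C))))%:E.
Proof.
elim: n j x => [|n IH] j x.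
  have KH1 : (0 <= K0 * H1)%R by exact: mulr_ge0.
  apply: (@le_trans _ _ (iter j T (fun y => (K0 * H1)%:E * one y) x)).
    apply: iter_le => //; [exact: nm|by apply: nnmM => //; exact: nnm_cst|].
    by move=> y; rewrite mule1; exact: moment_psi0_le.
  rewrite iter_transferZ// add0n mul0r addr0 (_ : l ^+ j * _ = K0 * H1 * (C * l ^+ j))%R; last by ring.
  by rewrite [leRHS]EFinM lee_wpmul2l.
have KHC : (0 <= K0 * H * C * l ^+ n)%R by rewrite !mulr_ge0.
have nA : nnm (fun y : RR => (K0 * H * C * l ^+ n)%:E * psi y).
  by apply: nnmM => //; exact: nnm_cst.
have nB : nnm (fun y : RR => psi y * moment one n y).
  by apply: nnmM; [exact: npsi|exact: nm].
apply: (@le_trans _ _ (iter j.+1 T (fun y => moment psi n y + (K0 * H * C * l ^+ n)%:E * psi y) x)).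
  rewrite iterSr; apply: iter_le => //.
  - exact: nm.
  - by apply: nT; apply: nnmD => //; exact: nm.
  move=> y; apply: le_trans (momentS_psi n y) _; apply: transfer_le => //.
  - by apply: nnmD => //; exact: nm.
  - by apply: nnmD => //; exact: nm.
  move=> z; rewrite leeD2l// muleC lee_wpmul2r//; exact: moment_one_lel.
rewrite iter_transferD//; last exact: nm.
rewrite iter_transferZ//.
apply: le_trans (leeD (IH j.+1 x) (lee_wpmul2l _ (psi_le j.+1 x))) _; first by rewrite lee_fin.
rewrite -EFinM -EFinD lee_fin addSnnS -[n.+1%:R]natr1 le_eqVlt; apply/orP; left; apply/eqP.
by rewrite exprD; ring.
Qed.

Lemma flat_mass_le n : \int[leb]_b flat_mass n b <= (C1 * (K0 * H * C * l ^+ n) * (2 * d))%:E.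
Proof.
rewrite int_flat_one; apply: (dot_ind_le me e_gt0 eC1); [exact: ltW|by rewrite !mulr_ge0|exact: nm|].
exact: moment_one_lel.
Qed.

Lemma flat_mass_ge : exists2 k : R, (0 < k)%R &
  forall n, (n0 <= n)%N -> (k * l ^+ n)%:E <= \int[leb]_b flat_mass n b.
Proof.
have E0 := massE0_gt0 me e_gt0 eC1 mh h0 hH d_gt0.
have JE : dot e1 J J = (massE e1 h d 0)%:E.
  exact: (massEE me e_gt0 eC1 mh h0 hH d_gt0 0).
exists (c0 * c0 * e1 0 * massE e1 h d 0 * c)%R; first by rewrite !mulr_gt0.
move=> n nn; rewrite int_flat_one.
set m := massE e1 h d 0 in E0 JE *.
have K1 : 0 <= (c0 * c0 * e1 0 * m)%:E by rewrite lee_fin !mulr_ge0// ltW.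
apply: (@le_trans _ _ (dot e1 J (fun x => (c0 * c0 * e1 0 * m)%:E * iter n T J x))).
  rewrite dotZ//; last exact: nTn.
  by rewrite -mulrA EFinM lee_wpmul2l//; exact: J_ge.
apply: dot_le => //; [|exact: nm|].
  by apply: nnmM; [split|exact: nTn].
by move=> x; apply: le_trans (moment_one_ge n x); rewrite EFinM JE.
Qed.

Lemma flat_moment_le : exists2 K : R, (0 < K)%R &
  forall n, \int[leb]_b (psi b * flat_mass n b) <= (K * n.+1%:R * l ^+ n)%:E.
Proof.
pose S : R := (K0 * H1 * C + K0 * H * C * (d + C) + d * (K0 * H * C))%R.
have d0 : (0 <= d)%R by exact: ltW.
have KHC : (0 <= K0 * H * C)%R by rewrite !mulr_ge0.
have KH1C : (0 <= K0 * H1 * C)%R by rewrite !mulr_ge0.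
have KHCd : (0 <= K0 * H * C * (d + C))%R by apply: mulr_ge0 => //; exact: addr_ge0.
have dK : (0 <= d * (K0 * H * C))%R by exact: mulr_ge0.
have S0 : (0 <= S)%R by rewrite !addr_ge0.
exists (C1 * S * (2 * d) + 1)%R.
  by rewrite ltr_wpDl// !mulr_ge0.
move=> n; rewrite int_flat//.
have nS : (0 <= S * n.+1%:R * l ^+ n)%R by rewrite !mulr_ge0.
apply: (@le_trans _ _ (\int[leb]_y ((C1 * (S * n.+1%:R * l ^+ n))%:E * J y))).
  apply: int_le => [||y].
  - by apply: nnmM; [exact: nnm_EFin|exact: nnm_shift_moment].
  - by apply: nnmM => //; apply: nnm_cst; exact: mulr_ge0.
  rewrite /ind; have [yd|_] := boolP (`|y| <= d)%R; last by rewrite mul0r mul0e mule0.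
  rewrite mul1r mule1 EFinM; apply: lee_pmul; rewrite ?lee_fin//.
    by apply: integral_ge0 => b _; rewrite mule_ge0// lee_fin.
  apply: le_trans (shift_moment_le n y) _.
  apply: (@le_trans _ _ ((l ^+ (n + 0) * (K0 * H1 * C + n%:R * (K0 * H * C * (`|y| + C))))%:E +
     (`|y|%R)%:E * (K0 * H * C * l ^+ n)%:E)).
    apply: leeD; first exact: (iter_moment_psi_le n 0 y).
    by rewrite lee_wpmul2l ?lee_fin//; exact: moment_one_lel.
  rewrite -EFinM -EFinD lee_fin addn0 -[n.+1%:R]natr1.
  have nn : (0 <= n%:R :> R)%R by [].
  rewrite [leLHS](_ : _ = l ^+ n * (K0 * H1 * C + n%:R * (K0 * H * C * (`|y| + C)) + `|y| * (K0 * H * C)))%R; last by ring.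
  rewrite mulrC ler_wpM2r//.
  have b1 : (`|y| * (K0 * H * C) <= d * (K0 * H * C))%R by rewrite ler_wpM2r.
  have b2 : (n%:R * (K0 * H * C * (`|y| + C)) <= n%:R * (K0 * H * C * (d + C)))%R.
    by rewrite ler_wpM2l// ler_wpM2l// lerD2r.
  have b3 : (n%:R * (K0 * H * C * (d + C)) <= n%:R * S)%R.
    by rewrite ler_wpM2l// /S; lra.
  rewrite /S; rewrite /S in b3; lra.
rewrite intZ//; last by rewrite lee_fin mulr_ge0.
rewrite integral_ind// -EFinM lee_fin.
have : (0 <= n.+1%:R * l ^+ n)%R by rewrite mulr_ge0.
move=> X0; rewrite [leLHS](_ : _ = C1 * S * (2 * d) * (n.+1%:R * l ^+ n))%R; last by ring.
by rewrite -[leRHS]mulrA ler_wpM2r// lerDl.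
Qed.

(** Markov's inequality: the radius [2 * K / k * n.+1] makes the mass outside at most
    [k / 2 * l ^+ n], half of the lower bound for the total mass. *)
Lemma flat_concentrated : exists B k : R, [/\ (0 < B)%R, (0 < k)%R &
  forall n, (n0 <= n)%N ->
    (k * l ^+ n)%:E <= \int[leb]_b ((ind (B * n.+1%:R) b)%:E * flat_mass n b)].
Proof.
have [k k0 mass] := flat_mass_ge; have [K Kp mom] := flat_moment_le.
have B0 : (0 < 2 * K / k)%R by rewrite divr_gt0// mulr_gt0.
exists (2 * K / k)%R, (k / 2)%R; split => //; first by rewrite divr_gt0.
move=> n nn; set A := (2 * K / k * n.+1%:R)%R.
have A0 : (0 < A)%R by rewrite mulr_gt0.
have nI : nnm (fun b : RR => (ind A b)%:E) by exact: nnm_ind.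
have ng := nnm_flat n.
have Ai : 0 <= A^-1%:E by rewrite lee_fin invr_ge0 ltW.
have npg : nnm (fun b : RR => psi b * flat_mass n b) by exact: nnmM.
have main : \int[leb]_b flat_mass n b <=
    \int[leb]_b ((ind A b)%:E * flat_mass n b) + A^-1%:E * \int[leb]_b (psi b * flat_mass n b).
  rewrite -intZ// -intD; [|exact: nnmM|by apply: nnmM => //; apply: nnm_cst; rewrite invr_ge0 ltW].
  apply: int_le => [||b] //.
    by apply: nnmD; [exact: nnmM|apply: nnmM => //; apply: nnm_cst; rewrite invr_ge0 ltW].
  rewrite muleA -ge0_muleDl ?lee_fin ?ind_ge0 ?mulr_ge0 ?invr_ge0 ?(ltW A0)//.
  rewrite -[leLHS]mul1e lee_wpmul2r//; first exact: ng.2.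
  rewrite -EFinM -EFinD lee_fin /ind; case: (leP `|b|%R A) => [_|Ab].
    by rewrite lerDl mulr_ge0// invr_ge0 ltW.
  by rewrite add0r mulrC ler_pdivlMr// mul1r ltW.
have := le_trans (mass n nn) (le_trans main (leeD2l _ (lee_wpmul2l Ai (mom n)))).
rewrite -EFinM (_ : A^-1 * _ = k / 2 * l ^+ n)%R; last first.
  by rewrite /A; field; rewrite !lt0r_neq0// addrC natr1.
move=> fin; rewrite -(@leeD2rE _ (k / 2 * l ^+ n)%:E)//.
by apply: le_trans fin; rewrite -EFinD lee_fin; lra.
Qed.

Lemma pinZ0_ub n : P n 0 0 <= (C1 * Ch * C1 * Ch * C * l ^+ n)%:E.
Proof.
have := P_le n 0%R 0%R; rewrite subr0 => /le_trans; apply.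
by rewrite -(mulrA _ C) [leRHS]EFinM lee_wpmul2l// lee_fin !mulr_ge0.
Qed.

Lemma pinZ0_overlap (q : nat) (t s : R) : (0 < t)%R -> (0 < s)%R ->
  (forall n b, s%:E * smooth t (flat_mass n) b <= flat_mass (n + q) b) ->
  exists2 k : R, (0 < k)%R & forall n, (n0 <= n)%N ->
    (k * (l ^+ (n + n) / n.+1%:R))%:E <= P ((n + q) + n).+3 0 0.
Proof.
move=> t0 s0 sm; have [B [k [B0 k0 conc]]] := flat_concentrated.
pose B' : R := (2 * B / t + 1)%R.
have B'0 : (0 < B')%R by rewrite addr_gt0// divr_gt0// mulr_gt0.
exists (c0 / e1 0 * s * (k ^+ 2 / (B' + 1)))%R.
  by rewrite !mulr_gt0 ?invr_gt0 ?exprn_gt0// addr_gt0.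
move=> n nn.
(* [M] cells of length [t] cover [[-A, A]]. Since [M] is linear in [n], the division by [M] in
   [overlap_ge] is the loss [1 / n.+1]. *)
pose A := (B * n.+1%:R)%R; pose M := (Num.truncn (2 * A / t)).+1.
have n1R : (1 <= n.+1%:R :> R)%R by rewrite ler1n.
have A0 : (0 <= A)%R by rewrite mulr_ge0// ltW.
have At0 : (0 <= 2 * A / t)%R by rewrite divr_ge0 ?mulr_ge0// ltW.
have AM : (2 * A < M%:R * t)%R by rewrite -ltr_pdivrMr// truncnS_gt.
have MB : (M%:R <= (B' + 1) * n.+1%:R)%R.
  rewrite /M -natr1; have := truncn_le (2 * A / t); rewrite At0 => tr.
  have : (2 * A / t = 2 * B / t * n.+1%:R)%R by rewrite /A; ring.
  move=> AE; rewrite AE in tr *; rewrite /B'; nra.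
have ng m := nnm_flat m.
have ov : (s * ((k * l ^+ n) ^+ 2 / M%:R))%:E <= \int[leb]_b (flat_mass n b * flat_mass (n + q) b).
  apply: (overlap_ge (ng n) (ng (n + q)%N) t0 s0 _ _ AM) => //.
  - by rewrite mulr_ge0// ltW.
  - exact: le_lt_trans (flat_mass_le n) (ltry _).
  - exact: conc.
have := le_trans (lee_wpmul2l _ ov) (site_overlap_ge (n + q) n); rewrite lee_fin (ltW c0_gt0) => /(_ isT).
rewrite site_overlapE => me0.
rewrite -(@lee_pmul2l _ (e1 0)%:E)// ?lte_fin//; apply: le_trans me0.
rewrite -!EFinM lee_fin.
have -> : (e1 0 * (c0 / e1 0 * s * (k ^+ 2 / (B' + 1)) * (l ^+ (n + n) / n.+1%:R)) =
    c0 * (s * ((k * l ^+ n) ^+ 2 * ((B' + 1) * n.+1%:R)^-1)))%R.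
  have X0 : (n.+1%:R != 0 :> R)%R by rewrite pnatr_eq0.
  have Y0 : (B' + 1 != 0)%R by rewrite lt0r_neq0// addr_gt0.
  have Z0 : (e1 0 != 0)%R by rewrite lt0r_neq0.
  rewrite exprD; move: (n.+1%:R : R)%R X0 (B' + 1)%R Y0 (e1 0%R) Z0 => X X0 Y Y0 Z Z0.
  by field; rewrite X0 Y0 Z0.
rewrite ler_wpM2l ?(ltW c0_gt0)// ler_wpM2l ?(ltW s0)// ler_wpM2l ?sqr_ge0//.
by rewrite lef_pV2// posrE// mulr_gt0// addr_gt0.
Qed.

Lemma pinZ0_lb : exists k : R, exists n1 : nat, (0 < k)%R /\ forall N, (n1 <= N)%N ->
  (k * (l ^+ N / N.+1%:R))%:E <= P N 0 0.
Proof.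
have [s2 s20 sm2] := flat2_ge; have [s3 s30 sm3] := flat3_ge.
have [k2 k20 lb2] := @pinZ0_overlap 2 (d / 2) s2 (divr_gt0 d_gt0 (ltr0n _ 2)) s20
  ltac:(by move=> n b; rewrite addn2; exact: sm2).
have [k3 k30 lb3] := @pinZ0_overlap 3 (d / 4) s3 (divr_gt0 d_gt0 (ltr0n _ 4)) s30
  ltac:(by move=> n b; rewrite addn3; exact: sm3).
(* The powers of [l] convert [l ^+ (n + n)] into [l ^+ N] for [N] equal to [n + n + 5] or
   [n + n + 6]. *)
pose r2 := (k2 / l ^+ 5)%R; pose r3 := (k3 / l ^+ 6)%R.
have r20 : (0 < r2)%R by rewrite divr_gt0// exprn_gt0.
have r30 : (0 < r3)%R by rewrite divr_gt0// exprn_gt0.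
exists (Num.min r2 r3), (n0 + n0 + 6)%N; split; first by rewrite lt_min r20.
move=> N nN.
have key (k : R) (r n : nat) : (0 < k)%R -> N = (n + n + r)%N ->
    (k / l ^+ r * (l ^+ N / N.+1%:R) <= k * (l ^+ (n + n) / n.+1%:R))%R.
  move=> kp NE; rewrite -mulrA ler_wpM2l ?(ltW kp)//.
  have -> : ((l ^+ r)^-1 * (l ^+ N / N.+1%:R) = l ^+ (n + n) / N.+1%:R)%R.
    by rewrite mulrA NE exprD (mulrC (l ^+ (n + n)))%R mulKf// expf_neq0// lt0r_neq0.
  rewrite ler_wpM2l// lef_pV2 ?posrE// ler_nat ltnS NE.
  by rewrite -addnA leq_addr.
have [n n0n [nE|nE]] := halve_large nN.
- apply: (@le_trans _ _ (k2 * (l ^+ (n + n) / n.+1%:R))%:E).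
    rewrite lee_fin; apply: le_trans (key _ _ n k20 nE).
    by rewrite ler_wpM2r ?divr_ge0// ge_min lexx.
  rewrite nE (_ : n + n + 5 = (n + 2 + n).+3)%N; first exact: lb2.
  by rewrite (addnAC n 2%N) !addnS !addn0.
- apply: (@le_trans _ _ (k3 * (l ^+ (n + n) / n.+1%:R))%:E).
    rewrite lee_fin; apply: le_trans (key _ _ n k30 nE).
    by rewrite ler_wpM2r ?divr_ge0// ge_min lexx orbT.
  rewrite nE (_ : n + n + 6 = (n + 3 + n).+3)%N; first exact: lb3.
  by rewrite (addnAC n 3%N) !addnS !addn0.
Qed.

End growth.

Lemma pinZ0_growth : exists l : R, exists C : R, exists k : R, exists n1 : nat,
  [/\ (0 < l)%R, (0 < C)%R, (0 < k)%R, (forall n, P n 0 0 <= (C * l ^+ n)%:E) &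
  forall N, (n1 <= N)%N -> (k * (l ^+ N / N.+1%:R))%:E <= P N 0 0].
Proof.
have [l [C [c [n0 [l0 C0 cp oneC [Jc psiC]]]]]] :=
  perron me e_gt0 eC1 e_decay mh h0 hCh hH hH1 d_gt0 c0_gt0 hc.
have [k [m [k0 lb]]] := pinZ0_lb l0 C0 cp oneC Jc psiC.
exists l, (C1 * Ch * C1 * Ch * C + 1)%R, k, m; split => //.
  by rewrite ltr_wpDl// !mulr_ge0// ltW.
move=> n; apply: le_trans (pinZ0_ub oneC n) _.
by rewrite lee_fin ler_wpM2r ?exprn_ge0 ?(ltW l0)// lerDl.
Qed.

End free_partition.

(** * Pinning inequalities *)

Section pinning_inequalities.
Context (R : realType) (e1 h : R -> R) (Ch C1 H eps : R).
Local Notation leb := (@lebesgue_measure R).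
Local Notation RR := (measurableTypeR R).
Hypotheses (me : measurable_fun [set: RR] (e1 : RR -> R)) (e_gt0 : forall x, 0 < e1 x).
Hypotheses (eC1 : forall x, e1 x <= C1).
Hypotheses (mh : measurable_fun [set: RR] (h : RR -> R)) (h0 : forall x, 0 <= h x).
Hypotheses (hCh : forall x, h x <= Ch) (hH : (\int[leb]_x (h x)%:E <= H%:E)%E).
Hypothesis eps_ge0 : 0 <= eps.
Local Open Scope ereal_scope.
Local Notation A := (pinZ e1 h eps).
Local Notation P := (pinZ e1 h 0).
Local Notation sw := (stepw e1 h).

Let e_ge0 x : (0 <= e1 x)%R. Proof. exact: ltW. Qed.
Let C1_ge0 : (0 <= C1)%R. Proof. exact: le_trans (e_ge0 0) (eC1 0). Qed.
Let Ch_ge0 : (0 <= Ch)%R. Proof. exact: le_trans (h0 0) (hCh 0). Qed.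
Let H_ge0 : (0 <= H)%R.
Proof.
by rewrite -lee_fin; apply: le_trans hH; apply: integral_ge0 => x _; rewrite lee_fin.
Qed.
Let Z0 z n a b : (0 <= z)%R -> 0 <= pinZ e1 h z n a b.
Proof. by move=> z0; exact: (nnm_pinZ me e_gt0 mh h0 n z0).2 (a, b). Qed.
Let nZ z n b : (0 <= z)%R -> nnm (fun c : RR => pinZ e1 h z n b c).
Proof. by move=> z0; apply: nnm_pinZ2 => //; mreal. Qed.
Let nw a b : nnm (fun c : RR => (sw a b c)%:E).
Proof. by apply: nnm_stepw => //; mreal. Qed.
Let w0 a b c : 0 <= (sw a b c)%:E.
Proof. by rewrite lee_fin; exact: stepw_ge0. Qed.

Lemma stepw_le a b c : (sw a b c <= C1 * Ch)%R.
Proof. by rewrite /stepw ler_pM. Qed.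

Lemma int_stepw_le a b : \int[leb]_c (sw a b c)%:E <= (C1 * H)%:E.
Proof.
have nh : nnm (fun c : RR => (h c)%:E) by exact: nnm_EFin.
have nhs : nnm (fun c : RR => (h (c + (a - 2 * b)))%:E).
  by apply: nnm_comp nh; mreal.
rewrite EFinM; apply: (@le_trans _ _ (C1%:E * \int[leb]_c (h (c + (a - 2 * b)))%:E)).
  rewrite -intZ// ?lee_fin//; apply: int_le => //.
    by apply: nnmM => //; exact: nnm_cst.
  by move=> c; rewrite -EFinM lee_fin /stepw addrA ler_wpM2r.
by rewrite (int_shift _ nh) lee_wpmul2l ?lee_fin.
Qed.

(** Each step contributes at most [eps * (C1 * Ch)] if pinned and [C1 * H] if free. The bound yields
    finiteness and the linear upper bound in Fekete's lemma. *)
Lemma pinZ_ub n a b :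
  A n a b <= ((C1 * Ch) * (C1 * Ch) * (eps * (C1 * Ch) + C1 * H) ^+ n)%:E.
Proof.
have CC : (0 <= C1 * Ch)%R by exact: mulr_ge0.
have CH : (0 <= C1 * H)%R by exact: mulr_ge0.
have G0 : (0 <= eps * (C1 * Ch) + C1 * H)%R by rewrite addr_ge0// mulr_ge0.
elim: n a b => [|n IH] a b.
  by rewrite /= lee_fin expr0 mulr1 ler_pM// ?stepw_ge0// stepw_le.
set X := (_ * _ ^+ n)%R in IH.
have X0 : (0 <= X)%R by rewrite mulr_ge0 ?mulr_ge0// exprn_ge0.
apply: (@le_trans _ _ (eps%:E * ((C1 * Ch)%:E * X%:E) + (C1 * H)%:E * X%:E)).
  apply: leeD.
    rewrite lee_wpmul2l ?lee_fin//; apply: lee_pmul => //; first exact: Z0.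
    by rewrite lee_fin stepw_le.
  apply: (@le_trans _ _ (\int[leb]_c ((sw a b c)%:E * X%:E))).
    apply: int_le => [||c].
    - by apply: nnmM; [exact: nw|exact: nZ].
    - by apply: nnmM; [exact: nw|exact: nnm_cst].
    - by rewrite lee_wpmul2l.
  by rewrite intZr// ?lee_fin// lee_wpmul2r ?lee_fin// int_stepw_le.
by rewrite -!EFinM -EFinD lee_fin /X exprS; lra.
Qed.

Lemma pinZS_le z n a b (k : R) (g : RR -> \bar R) : (0 <= z)%R -> (0 <= k)%R -> nnm g ->
  (forall c, k%:E * pinZ e1 h z n b c <= g c) ->
  k%:E * pinZ e1 h z n.+1 a b <=
  z%:E * ((sw a b 0)%:E * g 0%R) + \int[leb]_c ((sw a b c)%:E * g c).
Proof.
move=> z0 k0 ng kg.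
have nwZ : nnm (fun c : RR => (sw a b c)%:E * pinZ e1 h z n b c).
  by apply: nnmM; [exact: nw|exact: nZ].
rewrite ge0_muleDr; [|by apply: mule_ge0 => //; apply: mule_ge0 => //; exact: Z0|by apply: integral_ge0 => c _; exact: nwZ.2].
apply: leeD.
  by rewrite muleCA lee_wpmul2l ?lee_fin// muleCA lee_wpmul2l.
rewrite -intZ ?lee_fin//; apply: int_le => [||c].
- by apply: nnmM => //; exact: nnm_cst.
- exact: nnmM.
- by rewrite muleCA lee_wpmul2l.
Qed.

(** The two pinned heights are the final zeros of the first path and the initial zeros of the
    second; they count as integration variables of the long path, hence the index [(n + m).+2]. The
    heights [a, b] are arbitrary so that the induction can peel off steps on the left. *)
Lemma pinZ_superadditive n m a b :
  (eps ^+ 2)%:E * (A n a b * A m 0 0) <= A (n + m).+2 a b.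
Proof.
have [x xE] : exists x, A m 0 0 = x%:E.
  exists (fine (A m 0 0)); rewrite fineK// ge0_fin_numE ?Z0//.
  exact: le_lt_trans (pinZ_ub m 0 0) (ltry _).
have x0 : (0 <= x)%R by rewrite -lee_fin -xE Z0.
have ex0 : (0 <= eps ^+ 2 * x)%R by rewrite mulr_ge0// sqr_ge0.
rewrite xE muleA muleAC -EFinM.
elim: n a b => [|n IH] a b; last first.
  rewrite addSn.
  exact: (@pinZS_le eps n a b _ _ eps_ge0 ex0 (nZ (n + m).+2 b eps_ge0) (IH b)).
rewrite add0n.
apply: (@le_trans _ _ (eps%:E * ((sw a b 0)%:E * (eps%:E * ((sw b 0 0)%:E * x%:E))))).
  by rewrite -!EFinM lee_fin expr2; lra.
apply: (@le_trans _ _ (eps%:E * ((sw a b 0)%:E * A m.+1 b 0))).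
  rewrite lee_wpmul2l ?lee_fin// lee_wpmul2l//= xE leeDl//.
  by apply: integral_ge0 => c _; rewrite mule_ge0 ?Z0.
rewrite [leRHS]/= -/(pinZ _ _ _ _ _ _) leeDl//.
by apply: integral_ge0 => c _; rewrite mule_ge0 // (Z0 m.+1).
Qed.

(** Two disjoint parts of the reference measure: the first two heights both at the atom, or the
    first one in the Lebesgue part. *)
Lemma pinZ_first_step n a b :
  (eps ^+ 2)%:E * (P 0 a b * A n 0 0) + \int[leb]_c ((sw a b c)%:E * A n.+1 b c) <= A n.+2 a b.
Proof.
rewrite [leRHS]/=; apply: leeD => //.
rewrite (_ : (eps ^+ 2)%:E * (P 0 a b * A n 0 0) =
    eps%:E * ((sw a b 0)%:E * (eps%:E * ((sw b 0 0)%:E * A n 0 0)))); last first.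
  rewrite /= expr2 (EFinM eps) (EFinM (sw a b 0)) -!muleA; congr (_ * _).
  by rewrite [LHS]muleCA.
rewrite lee_wpmul2l ?lee_fin// lee_wpmul2l// leeDl//.
by apply: integral_ge0 => c _; rewrite mule_ge0 ?Z0.
Qed.

(** Decomposition according to the number [k] of heights in the Lebesgue part before the first
    pinned pair. Paths with isolated pinned heights before that pair are discarded, hence an
    inequality. *)
Lemma pinZ_renewal n a b :
  \sum_(k < n.+1) (eps ^+ 2)%:E * (P k a b * A (n - k) 0 0) <= A n.+2 a b.
Proof.
have e2 : 0 <= (eps ^+ 2)%:E by rewrite lee_fin sqr_ge0.
elim: n a b => [|n IH] a b; apply: le_trans (pinZ_first_step _ a b);
  rewrite big_ord_recl subn0; apply: leeD => //.
  by rewrite big_ord0; apply: integral_ge0 => c _; rewrite mule_ge0 // (Z0 1).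
have nterm (k : nat) : nnm (fun c : RR => (eps ^+ 2)%:E * (P k b c * A (n - k) 0 0)).
  apply: nnmM; first by apply: nnm_cst; exact: sqr_ge0.
  by apply: nnmM; [exact: nZ|split=> // _; exact: Z0].
apply: (@le_trans _ _ (\int[leb]_c ((sw a b c)%:E *
    \sum_(k < n.+1) (eps ^+ 2)%:E * (P k b c * A (n - k) 0 0)))); last first.
  apply: int_le => [||c].
  - apply: nnmM => //; split=> [|c]; last by apply: sume_ge0 => k _; apply: (nterm k).2.
    by apply: emeasurable_sum => k _; apply: (nterm k).1.
  - by apply: nnmM; [exact: nw|exact: nZ].
  - by rewrite lee_wpmul2l.
have -> : \int[leb]_c ((sw a b c)%:E * \sum_(k < n.+1) (eps ^+ 2)%:E * (P k b c * A (n - k) 0 0)) =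
    \int[leb]_c \sum_(k < n.+1) ((sw a b c)%:E * ((eps ^+ 2)%:E * (P k b c * A (n - k) 0 0))).
  apply: eq_integral => c _; rewrite ge0_sume_distrr// => k _; exact: (nterm k).2.
rewrite ge0_integral_sum//; last 2 first.
- by move=> k; apply: (nnmM (nw a b) (nterm k)).1.
- by move=> k c _; apply: (nnmM (nw a b) (nterm k)).2.
apply: lee_sum => k _; rewrite lift0 subSS pinZ0S.
have nwP : nnm (fun c : RR => (sw a b c)%:E * P k b c).
  by apply: nnmM; [exact: nw|exact: nZ].
rewrite -intZr//; last exact: Z0.
rewrite -intZ//; last first.
  by apply: nnmM => //; split=> // _; exact: Z0.
rewrite le_eqVlt; apply/orP; left; apply/eqP; apply: eq_integral => c _.
by rewrite [RHS]muleCA !muleA.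
Qed.

Lemma pinZ_mono n a b : P n a b <= A n a b.
Proof.
elim: n a b => [|n IH] a b //.
rewrite pinZ0S -[leLHS]add0e; apply: leeD.
  by apply: mule_ge0 => //; apply: mule_ge0 => //; exact: Z0.
apply: int_le => [||c]; try by apply: nnmM; [exact: nw|exact: nZ].
by rewrite lee_wpmul2l.
Qed.

End pinning_inequalities.

(** * Renewal argument *)

Section renewal.
Context (R : realType).

Lemma convolution_sum (w v : nat -> R) N :
  \sum_(n < N) \sum_(k < n.+1) w k * v (n - k)%N =
  \sum_(k < N) w k * \sum_(j < N - k) v j.
Proof.
elim: N => [|N IH]; first by rewrite !big_ord0.
rewrite big_ord_recr/= IH.
transitivity (\sum_(k < N.+1) (w k * (\sum_(j < N - k) v j) + w k * v (N - k)%N)).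
  by rewrite big_split/= [in RHS]big_ord_recr/= subnn big_ord0 mulr0 addr0.
apply: eq_bigr => -[k kN] _ /=; rewrite -mulrDr; congr (_ * _).
by rewrite subSn// big_ord_recr.
Qed.

(** Dyadic blocks: the [m] terms of index between [m] and [2m - 1] are at least [k / (2m)] each. *)
Lemma harmonic_lower_sum (w : nat -> R) (k : R) (n1 : nat) : 0 < k ->
  (forall n, 0 <= w n) -> (forall n, (n1 <= n)%N -> k / n.+1%:R <= w n) ->
  forall X : R, exists M, X <= \sum_(n < M) w n.
Proof.
move=> k0 w0 wk X.
have double m : (0 < m)%N -> (n1 <= m)%N ->
    \sum_(n < m) w n + k / 2 <= \sum_(n < m + m) w n.
  move=> m0 n1m; rewrite big_split_ord/= lerD2l.
  have m0R : 0 < m%:R :> R by rewrite ltr0n.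
  apply: (@le_trans _ _ (\sum_(i < m) k / (m + m)%:R)).
    rewrite sumr_const card_ord -[_ *+ m]mulr_natr natrD.
    move: (m%:R : R) m0R => x x0; rewrite [leRHS](_ : _ = k / 2)//; field.
    by rewrite !lt0r_neq0// addr_gt0.
  apply: ler_sum => i _; apply: le_trans (wk _ _); last exact: leq_trans n1m (leq_addr _ _).
  rewrite ler_pM2l// lef_pV2 ?posrE ?ltr0n ?addn_gt0 ?m0//.
  by rewrite ler_nat -addnS leq_add2l.
have pow j : exists2 m, [/\ (0 < m)%N & (n1 <= m)%N] & j%:R * (k / 2) <= \sum_(n < m) w n.
  elim: j => [|j [m [m0 nm] IH]].
    by exists n1.+1; [split|rewrite mul0r sumr_ge0].
  exists (m + m)%N; first by rewrite addn_gt0 m0; split=> //; exact: leq_trans nm (leq_addr _ _).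
  by apply: le_trans (double m m0 nm); rewrite -natr1 mulrDl mul1r lerD2r.
have k20 : 0 < k / 2 by rewrite divr_gt0.
have [m _ h] := pow (Num.truncn (`|X| / (k / 2))).+1.
exists m; apply: le_trans h; rewrite (le_trans (ler_norm _))// -ler_pdivrMr//.
by rewrite ltW// truncnS_gt.
Qed.

(** Summing the renewal inequality bounds [2 * S K] by [S (K + M.+2)], where [S] denotes the partial
    sums of [v]. As [v <= V], the latter is at most [S K + M.+2 * V], so [S] is bounded, although it
    dominates the divergent sums of [w]. *)
Lemma renewal_unbounded (w v : nat -> R) (theta V : R) : 0 < theta ->
  (forall n, 0 <= w n) -> (forall n, w n <= v n) -> (forall n, v n <= V) ->
  (forall n, theta * \sum_(k < n.+1) w k * v (n - k)%N <= v n.+2) ->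
  (forall X, exists M, X <= \sum_(n < M) w n) -> False.
Proof.
move=> t0 w0 wv vV ren dvg.
have v0 n : 0 <= v n by exact: le_trans (w0 n) (wv n).
(* With this [M] the first [M] weights, multiplied by [theta], sum to at least 2. *)
have [M wM] := dvg (2 / theta).
pose S n := \sum_(j < n) v j.
have S0 n : 0 <= S n by rewrite sumr_ge0.
have Sadd n m : S n <= S (n + m)%N by rewrite /S big_split_ord/= lerDl sumr_ge0.
have Sub n m : S (n + m)%N <= S n + m%:R * V.
  rewrite /S big_split_ord/= lerD2l.
  apply: le_trans (ler_sum (G := fun=> V) _ _) _; first by move=> i _; exact: vV.
  by rewrite sumr_const card_ord mulr_natl.
have bound K : S K <= M.+2%:R * V.
  have conv : theta * \sum_(k < (M + K)%N) w k * S (M + K - k)%N <= S (K + M.+2)%N.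
    rewrite -convolution_sum mulr_sumr.
    apply: (@le_trans _ _ (\sum_(n < (M + K)%N) v n.+2)); first by apply: ler_sum => n _; exact: ren.
    rewrite /S (_ : (K + M.+2 = (M + K).+2)%N); last by rewrite !addnS addnC.
    by rewrite [leRHS]big_ord_recl big_ord_recl/= addrA lerDr addr_ge0.
  have : 2 * S K <= theta * \sum_(k < (M + K)%N) w k * S (M + K - k)%N.
    rewrite -ler_pdivrMl// mulrA (mulrC _ 2).
    apply: le_trans (ler_wpM2r (S0 K) wM) _.
    rewrite big_split_ord/= mulr_suml -[leLHS]addr0 lerD//; last first.
      by apply: sumr_ge0 => i _; rewrite mulr_ge0.
    apply: ler_sum => i _; rewrite ler_wpM2l//.
    have iM : (i <= M)%N by exact: ltnW.
    by rewrite (_ : (M + K - i = K + (M - i))%N) ?Sadd// addnC addnBA.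
  by have := Sub K M.+2; lra.
have [N wN] := dvg (M.+2%:R * V + 1).
have : \sum_(n < N) w n <= S N by apply: ler_sum.
by have := bound N; lra.
Qed.

(** The free energy is the difference between the Fekete rate of the pinned weights [a] and the rate
    [ln l] of the free weights [b], whose polynomial factors disappear in the limit. A system of
    size [N] has [N.-1] free heights. *)
Lemma localization (a b : nat -> R) (e2 l C k K G : R) (n1 : nat) :
  0 < e2 -> 0 < l -> 0 < C -> 0 < k -> 0 < K -> 0 < G ->
  (forall n, 0 <= b n) -> (forall n, b n <= a n) ->
  (forall n, b n <= C * l ^+ n) ->
  (forall n, (n1 <= n)%N -> k * (l ^+ n / n.+1%:R) <= b n) ->
  (forall n, a n <= K * G ^+ n) ->
  (forall n m, e2 * (a n * a m) <= a (n + m).+2) ->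
  (forall n, e2 * \sum_(j < n.+1) b j * a (n - j)%N <= a n.+2) ->
  exists2 F : R, 0 < F & ln (a N.-1 / b N.-1) / N%:R @[N --> \oo] --> F.
Proof.
move=> e20 l0 C0 k0 K0 G0 b0 ba bub blb aub asup aren.
have ln0 n : 0 < l ^+ n by rewrite exprn_gt0.
have bpos n : (n1 <= n)%N -> 0 < b n.
  by move=> nn; apply: lt_le_trans (blb n nn); rewrite mulr_gt0// divr_gt0.
have apos n : (n1 <= n)%N -> 0 < a n by move=> nn; apply: lt_le_trans (bpos n nn) (ba n).
(* The shift by 2 and the factor [e2] absorb the pinned pair, so that [u] is exactly
   superadditive. *)
pose u n := ln (e2 * a (n - 2)%N).
have upos n : (n1.+2 <= n)%N -> 0 < e2 * a (n - 2)%N.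
  case: n => [|[|n]]; rewrite ?ltnS ?ltn0 // => nn.
  by apply: mulr_gt0 => //; apply: apos; rewrite !subSS subn0.
have [||L ulim uL] := @fekete R u n1.+2 (`|ln (e2 * K)| + `|ln G|) isT.
- move=> n m nn mm; have un := upos n nn; have um := upos m mm.
  have unm : 0 < e2 * a (n + m - 2)%N by apply: upos; exact: leq_trans nn (leq_addr _ _).
  rewrite /u -lnM ?posrE// ler_ln ?posrE//; last exact: mulr_gt0.
  have -> : (n + m - 2 = ((n - 2) + (m - 2)).+2)%N.
    clear un um unm; case: n nn => [|[|n]]// _; case: m mm => [|[|m]]// _.
    by rewrite addSn addSn !subSS !subn0 addnS addnS.
  by rewrite -!mulrA ler_pM2l// mulrCA; exact: asup.
- move=> n nn; rewrite /u; apply: (@le_trans _ _ (ln (e2 * K * G ^+ (n - 2)))).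
    by rewrite ler_ln ?posrE ?upos ?mulr_gt0 ?exprn_gt0// -mulrA ler_pM2l.
  rewrite lnM ?posrE ?mulr_gt0 ?exprn_gt0// lnXn// -(mulr_natr (ln G)) mulrDl.
  have n0R : 1 <= n%:R :> R by rewrite ler1n; exact: leq_trans nn.
  apply: lerD; first by rewrite (le_trans (ler_norm _))// ler_peMr.
  apply: (@le_trans _ _ (`|ln G| * (n - 2)%:R)); first by rewrite ler_wpM2r// ler_norm.
  by rewrite ler_wpM2l// ler_nat leq_subr.
(* As [L] is a supremum, [L <= ln l] would imply [e2 * a n <= l ^+ n.+2] for [n >= n1], so the
   ratios [a n / l ^+ n] would be bounded and contradict [renewal_unbounded]. *)
have Ll : ln l < L.
  rewrite ltNge; apply/negP => lL.
  pose w n := b n / l ^+ n; pose v n := a n / l ^+ n.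
  have w0 n : 0 <= w n by rewrite divr_ge0// ltW.
  have wv n : w n <= v n by rewrite ler_wpM2r// invr_ge0 ltW.
  have v0 n : 0 <= v n by exact: le_trans (w0 n) (wv n).
  have vlarge n : (n1 <= n)%N -> v n <= l ^+ 2 / e2.
    move=> nn; rewrite ler_pdivrMr// mulrAC ler_pdivlMr// -exprD add2n mulrC.
    have nn2 : (n1.+2 <= n.+2)%N by [].
    have := uL n.+2 nn2; have := upos n.+2 nn2; rewrite /u subSS subSS subn0 => p1 le1.
    rewrite -[leLHS]lnK ?posrE// -[leRHS]lnK ?posrE ?exprn_gt0// ler_expR.
    apply: le_trans le1 _; by rewrite lnXn// -(mulr_natr (ln l)) ler_wpM2r.
  pose V := l ^+ 2 / e2 + \sum_(j < n1) v j.
  have vV n : v n <= V.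
    have [nn|nn] := leqP n1 n.
      by rewrite (le_trans (vlarge n nn))// lerDl sumr_ge0.
    by rewrite /V (bigD1 (Ordinal nn))//= addrCA lerDl addr_ge0 ?sumr_ge0// divr_ge0// ltW.
  apply: (@renewal_unbounded w v (e2 / l ^+ 2) V) => //.
  - by rewrite divr_gt0.
  - move=> n; rewrite /v ler_pdivlMr//; apply: le_trans (aren n).
    have -> : \sum_(j < n.+1) b j * a (n - j)%N = l ^+ n * \sum_(j < n.+1) w j * v (n - j)%N.
      rewrite mulr_sumr; apply: eq_bigr => -[j jn] _ /=.
      have lE : l ^+ n = l ^+ j * l ^+ (n - j) by rewrite -exprD subnKC.
      rewrite /w /v lE; field.
      by rewrite !lt0r_neq0.
    rewrite (_ : l ^+ n.+2 = l ^+ 2 * l ^+ n); last by rewrite -exprD add2n.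
    rewrite le_eqVlt; apply/orP; left; apply/eqP.
    by field; rewrite lt0r_neq0.
  - apply: (@harmonic_lower_sum w k n1) => // n nn.
    by rewrite /w ler_pdivlMr// (le_trans _ (blb n nn))// mulrA mulrAC.
exists (L - ln l); first by rewrite subr_gt0.
have ulim1 : u n.+1 / n.+1%:R @[n --> \oo] --> L by rewrite (cvg_shiftS (fun n => u n / n%:R)).
have inv0 : n%:R^-1 @[n --> \oo] --> (0 : R).
  rewrite -(cvg_shiftS (fun n => n%:R^-1 : R)); exact: cvg_harmonic.
have ratio1 : n.+1%:R / n%:R @[n --> \oo] --> (1 : R).
  have : 1 + n%:R^-1 @[n --> \oo] --> (1 + 0 : R) by apply: cvgD => //; exact: cvg_cst.
  rewrite addr0; apply: cvg_trans; apply: near_eq_cvg; near=> n.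
  have n0 : n%:R != 0 :> R by rewrite pnatr_eq0 -lt0n; near: n; exists 1%N.
  by rewrite -natr1 mulrDl divff// mul1r.
have alim : ln (a n.-1) / n%:R @[n --> \oo] --> L.
  have : u n.+1 / n.+1%:R * (n.+1%:R / n%:R) - ln (e2) * n%:R^-1 @[n --> \oo] -->
      L * 1 - ln (e2) * 0.
    by apply: cvgB; apply: cvgM => //; exact: cvg_cst.
  rewrite mulr1 mulr0 subr0; apply: cvg_trans; apply: near_eq_cvg; near=> n.
  have nn : (n1.+2 <= n.+1)%N by near: n; exists n1.+1.
  have ap : 0 < a n.-1 by apply: apos; rewrite -ltnS prednK//; case: (n) nn.
  rewrite mulrA divfK// -mulrBl; congr (_ / _).
  by rewrite /u subSS subn1 lnM ?posrE// addrAC subrr add0r.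
have blim : ln (b n.-1) / n%:R @[n --> \oo] --> ln l.
  rewrite -(cvg_shiftS (fun n => ln (b n.-1) / n%:R)) /=.
  have inv1 : n.+1%:R^-1 @[n --> \oo] --> (0 : R) by exact: cvg_harmonic.
  (* The polynomial factor costs [ln n.+1 / n.+1], at most twice this square root, because the
     logarithm of [x] is twice that of its root and [ln y < y]. *)
  have sq0 : Num.sqrt (n.+1%:R^-1) @[n --> \oo] --> (0 : R).
    by rewrite -[X in _ --> X]sqrtr0; apply: continuous_cvg inv1; exact: sqrt_continuous.
  have lo : (ln k - ln l) * n.+1%:R^-1 + ln l - 2 * Num.sqrt (n.+1%:R^-1) @[n --> \oo] -->
      (ln k - ln l) * 0 + ln l - 2 * 0.
    by apply: cvgB; [apply: cvgD; [apply: cvgMr|exact: cvg_cst]|apply: cvgMr].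
  have up : (ln C - ln l) * n.+1%:R^-1 + ln l @[n --> \oo] --> (ln C - ln l) * 0 + ln l.
    by apply: cvgD; [apply: cvgMr|exact: cvg_cst].
  rewrite !mulr0 add0r ?subr0 in lo up.
  apply: (squeeze_cvgr _ lo up); near=> n.
  have n1n : (n1 <= n)%N by near: n; exists n1.
  have n0R : 0 < n.+1%:R :> R by [].
  have lnE : ln (l ^+ n) / n.+1%:R = ln l - ln l / n.+1%:R.
    rewrite lnXn// -(mulr_natr (ln l)); have : n.+1%:R = n%:R + 1 :> R by rewrite natr1.
    move=> E; have -> : n%:R = n.+1%:R - 1 :> R by rewrite E; ring.
    by rewrite mulrBr mulr1 mulrBl mulfK// lt0r_neq0.
  have bp := bpos n n1n.
  apply/andP; split; last first.
    apply: (@le_trans _ _ ((ln C + ln (l ^+ n)) / n.+1%:R)).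
      by rewrite ler_pM2r ?invr_gt0// -lnM ?posrE// ler_ln ?posrE// mulr_gt0.
    rewrite mulrDl lnE; move: (n.+1%:R^-1 : R) => i.
    by rewrite le_eqVlt; apply/orP; left; apply/eqP; ring.
  apply: (@le_trans _ _ ((ln k + ln (l ^+ n) - ln n.+1%:R) / n.+1%:R)); last first.
    rewrite ler_pM2r ?invr_gt0// -lnM ?posrE// -ln_div ?posrE ?mulr_gt0//.
    rewrite ler_ln ?posrE ?divr_gt0 ?mulr_gt0//.
    by rewrite -mulrA; exact: blb.
  rewrite [leRHS]mulrBl [in leRHS]mulrDl lnE.
  set s := Num.sqrt _; have s0 : 0 < s by rewrite sqrtr_gt0 invr_gt0.
  have sE : n.+1%:R^-1 = s ^+ 2 by rewrite sqr_sqrtr// invr_ge0 ltW.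
  have : ln n.+1%:R / n.+1%:R <= 2 * s.
    have -> : ln n.+1%:R = 2 * ln s^-1.
      rewrite -[n.+1%:R]invrK sE -exprVn lnXn ?invr_gt0// mulr_natl//.
    rewrite sE; have : ln s^-1 < s^-1 by apply: ln_sublinear; rewrite invr_gt0.
    move=> ls; have : ln s^-1 * s ^+ 2 <= s^-1 * s ^+ 2 by rewrite ler_wpM2r ?sqr_ge0// ltW.
    have -> : s^-1 * s ^+ 2 = s by rewrite expr2 mulKf// lt0r_neq0.
    by move: (ln s^-1) (s ^+ 2) => x y; lra.
  move: (n.+1%:R^-1 : R) => i; lra.
have main : ln (a N.-1) / N%:R - ln (b N.-1) / N%:R @[N --> \oo] --> L - ln l by exact: cvgB.
apply: cvg_trans main; apply: near_eq_cvg; near=> n.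
have n1n : (n1 < n)%N by near: n; exists n1.+1.
have nn : (n1 <= n.-1)%N by rewrite -ltnS prednK//; exact: leq_ltn_trans n1n.
by rewrite ln_div ?posrE ?apos ?bpos// mulrBl.
Unshelve. all: end_near. Qed.

End renewal.

(** * The free energy *)

Section partition_recursion.
Context (R : realType) (e1 h : R -> R).
Local Notation leb := (@lebesgue_measure R).
Local Notation RR := (measurableTypeR R).
Hypotheses (me : measurable_fun [set: RR] (e1 : RR -> R)) (e_gt0 : forall x, 0 < e1 x).
Hypotheses (mh : measurable_fun [set: RR] (h : RR -> R)) (h0 : forall x, 0 <= h x).
Local Notation sw := (stepw e1 h).

Fixpoint path_weight (a b : R) (s : seq R) : R :=
  match s with
  | [::] => sw a b 0 * sw b 0 0
  | c :: s' => sw a b c * path_weight b c s'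
  end.

Lemma path_weightE a b s : path_weight a b s =
  \prod_(i < (size s).+2) sw (nth 0 (a :: b :: s) i) (nth 0 (b :: s) i) (nth 0 s i).
Proof.
elim: s a b => [|c s IH] a b.
  by rewrite !big_ord_recl big_ord0 mulr1.
by rewrite [LHS]/= IH [in RHS]big_ord_recl.
Qed.

Lemma eq_iter_int (mu : {measure set RR -> \bar R}) n (f g : seq R -> \bar R) :
  (forall s, size s = n -> f s = g s) -> iter_int mu n f = iter_int mu n g.
Proof.
elim: n f g => [|n IH] f g fg /=; first exact: fg.
by apply: eq_integral => x _; apply: IH => s sn; rewrite fg//= sn.
Qed.

Lemma integral_pin_measure (eps : {nonneg R}) (f : RR -> \bar R) : nnm f ->
  (\int[pin_measure eps]_x f x = eps%:num%:E * f 0%R + \int[leb]_x f x)%E.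
Proof.
move=> [mf f0]; rewrite ge0_integral_measure_add//; congr (_ + _)%E.
rewrite ge0_integral_mscale//; congr (_ * _)%E.
by rewrite integral_dirac// diracT mul1e.
Qed.

(** The scalar [k] carries the weight of the steps already peeled off, so that the induction
    hypothesis applies under the integral. *)
Lemma iter_int_path_weight (eps : {nonneg R}) n (k a b : R) : 0 <= k ->
  iter_int (pin_measure eps) n (fun s => (k * path_weight a b s)%:E) =
  (k%:E * pinZ e1 h eps%:num n a b)%E.
Proof.
elim: n k a b => [|n IH] k a b k0 //=.
have e0 : 0 <= eps%:num by [].
have nwZ : nnm (fun c : RR => (sw a b c)%:E * pinZ e1 h eps%:num n b c)%E.
  apply: nnmM; first by apply: nnm_stepw => //; mreal.
  by apply: nnm_pinZ2 => //; mreal.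
transitivity (\int[pin_measure eps]_c (k%:E * ((sw a b c)%:E * pinZ e1 h eps%:num n b c)))%E.
  apply: eq_integral => c _.
  have -> : (fun s => (k * (sw a b c * path_weight b c s))%:E) =
      (fun s => (k * sw a b c * path_weight b c s)%:E).
    by apply/funext => s; rewrite mulrA.
  rewrite IH; last by rewrite mulr_ge0// stepw_ge0.
  by rewrite EFinM muleA.
rewrite intZ ?lee_fin// integral_pin_measure//.
Qed.

End partition_recursion.

(** The leading zeros are the left boundary heights; the default value 0 of [nth] supplies those on
    the right. *)
Lemma fieldE (R : realType) (N : nat) (s : seq R) (i : nat) : size s = N.-1 ->
  [/\ field N s (i%:Z - 1) = nth 0 (0 :: 0 :: s) i, field N s i%:Z = nth 0 (0 :: s) i &
      field N s (i%:Z + 1) = nth 0 s i].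
Proof.
move=> sN.
have fE (j : nat) : field N s j%:Z = nth 0 (0 :: s) j.
  rewrite /field; case: j => [|j] //=; rewrite ltz_nat.
  by case: ltnP => // Nj; rewrite nth_default// sN; case: N Nj {sN}.
split=> //; last by rewrite -PoszD addn1 fE.
case: i => [|i]; first by rewrite /field.
by rewrite intS addrAC subrr add0r fE.
Qed.

Lemma measurable_expRN (R : realType) (V : R -> R) :
  measurable_fun [set: measurableTypeR R] (V : measurableTypeR R -> R) ->
  measurable_fun [set: measurableTypeR R] (fun x : measurableTypeR R => expR (- V x)).
Proof. by move=> mV; apply: measurableT_comp => //; exact: measurable_funN. Qed.

Lemma partitionE (R : realType) (V1 V2 : R -> R) (eps : {nonneg R}) (N : nat) :
  measurable_fun [set: measurableTypeR R] (V1 : measurableTypeR R -> R) ->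
  measurable_fun [set: measurableTypeR R] (V2 : measurableTypeR R -> R) ->
  (0 < N)%N -> Defs.partition V1 V2 eps N =
  pinZ (fun x => expR (- V1 x)) (fun x => expR (- V2 x)) eps%:num N.-1 0 0.
Proof.
move=> mV1 mV2 N0.
have mexp := @measurable_expRN R.
rewrite -[RHS]mul1e -iter_int_path_weight; [|exact: mexp|by move=> x; exact: expR_gt0|exact: mexp|by move=> x; exact: expR_ge0|exact: ler01].
apply: eq_iter_int => s sN; rewrite mul1r; congr (_%:E).
(* The shift pairs the gradient of index [i + 1] with the Laplacian of index [i], the two terms
   charged by the i-th step weight. *)
rewrite path_weightE /hamiltonian sN prednK// big_add1/= -big_split/= big_mkord -sumrN expR_sum.
apply: eq_bigr => i _; have [E1 E2 E3] := fieldE i sN.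
rewrite /stepw opprD expRD intS (addrAC 1) subrr add0r (addrC 1).
by rewrite E1 E2 E3.
Qed.

Theorem theorem1p1 (R : realType) (V1 V2 : R -> R)
  (mV1 : measurable_fun setT V1) (mV2 : measurable_fun setT V2)
  (* (C1) *)
  (V1_lb : exists m : R, forall x, m <= V1 x)
  (V1_sym : forall x, V1 x = V1 (- x))
  (V1_infty_p : V1 x @[x --> +oo] --> +oo)
  (V1_infty_n : V1 x @[x --> -oo] --> +oo)
  (V1_int : (\int[@lebesgue_measure R]_x (expR (- (2 * V1 x)))%:E < +oo)%E)
  (* (C2) *)
  (V2_lb : exists m : R, forall x, m <= V2 x)
  (V2_loc : exists2 gamma : R, 0 < gamma &
              exists M : R, forall x, `|x| <= gamma -> V2 x <= M)
  (V2_int : (\int[@lebesgue_measure R]_x (`|x| * expR (- V2 x))%:E < +oo)%E)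
  (eps : {nonneg R}) (eps_pos : 0 < eps%:num) :
  exists2 F : R, 0 < F & free_energy_seq V1 V2 eps n @[n --> \oo] --> F.
Proof.
pose leb := @lebesgue_measure R.
pose e1 x := expR (- V1 x); pose h x := expR (- V2 x).
have me := measurable_expRN mV1; have mh := measurable_expRN mV2.
have e_gt0 x : 0 < e1 x by exact: expR_gt0.
have h0 x : 0 <= h x by exact: expR_ge0.
have e_even x : e1 (- x) = e1 x by rewrite /e1 -V1_sym.
have [m1 V1m] := V1_lb; have [m2 V2m] := V2_lb.
have eC1 x : e1 x <= expR (- m1) by rewrite ler_expR lerN2.
have hCh x : h x <= expR (- m2) by rewrite ler_expR lerN2.
have e_decay (k : R) : 0 < k -> exists L : R, forall x, L <= `|x| -> e1 x <= k.
  move=> k0.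
  have [Mp [_ Hp]] := (cvgryPge _).1 V1_infty_p (- ln k).
  have [Mn [_ Hn]] := (cvgryPge _).1 V1_infty_n (- ln k).
  (* The margin 1 turns the comparison with both thresholds into strict inequalities. *)
  exists (Num.max Mp (- Mn) + 1) => x Lx.
  have le1 := le_max Mp Mp (- Mn); have le2 := le_max (- Mn) Mp (- Mn).
  rewrite lexx orTb in le1; rewrite lexx orbT in le2.
  rewrite /e1 -[leRHS]lnK ?posrE// ler_expR lerNl.
  have [x0|x0] := leP 0 x.
    by apply: Hp; rewrite ger0_norm// in Lx; lra.
  by apply: Hn; rewrite ltr0_norm// in Lx; lra.
have nh1 : nnm (fun x : measurableTypeR R => (`|x| * h x)%:E).
  by apply: nnm_EFin => [|x]; [mreal|exact: mulr_ge0].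
have nh : nnm (fun x : measurableTypeR R => (h x)%:E) by exact: nnm_EFin.
have [H1 hH1] : exists H1 : R, (\int[leb]_x (`|x| * h x)%:E <= H1%:E)%E.
  exists (fine (\int[leb]_x (`|x| * h x)%:E)); rewrite fineK// ge0_fin_numE//.
  by apply: integral_ge0 => x _; exact: nh1.2.
have [H hH] : exists H : R, (\int[leb]_x (h x)%:E <= H%:E)%E.
  (* On [[-1, 1]] the kernel [h] is at most [expR (- m2)]; elsewhere it is at most [|x| * h x]. *)
  exists (expR (- m2) * (2 * 1) + H1).
  apply: (@le_trans _ _ (\int[leb]_x ((expR (- m2))%:E * (ind 1 x)%:E + (`|x| * h x)%:E))%E).
    have nI : nnm (fun x : measurableTypeR R => (expR (- m2))%:E * (ind 1 x)%:E)%E.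
      by apply: nnmM; [apply: nnm_cst; exact: expR_ge0|exact: nnm_ind].
    apply: int_le => //; first exact: nnmD.
    move=> x; rewrite -EFinM -EFinD lee_fin /ind; case: (leP `|x| 1) => [_|/ltW x1].
      by rewrite mulr1 ler_wpDr ?mulr_ge0.
    by rewrite mulr0 add0r ler_peMl.
  rewrite intD//; last by apply: nnmM; [apply: nnm_cst; exact: expR_ge0|exact: nnm_ind].
  rewrite intZ; [|exact: nnm_ind|by rewrite lee_fin expR_ge0].
  by rewrite integral_ind// EFinD leeD.
have [gamma g0 [M VM]] := V2_loc.
(* With [d = gamma / 2], two increments in [[-d, d]] differ by at most [gamma], the range on which
   [V2] is bounded above. *)
have d_gt0 : 0 < gamma / 2 by rewrite divr_gt0.
have c0_gt0 : 0 < expR (- M) by exact: expR_gt0.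
have hc x : `|x| <= 2 * (gamma / 2) -> expR (- M) <= h x.
  by move=> xg; rewrite ler_expR lerN2 VM//; move: xg; rewrite mulrC divfK.
have [l [C [k [n1 [l0 C0 k0 bub blb]]]]] := pinZ0_growth me e_gt0 e_even eC1 e_decay
  mh h0 hCh hH hH1 d_gt0 c0_gt0 hc.
have epsg : 0 <= eps%:num by exact: ltW.
set z := eps%:num in eps_pos epsg.
have C1_gt0 : 0 < expR (- m1) :> R by exact: expR_gt0.
have Ch_gt0 : 0 < expR (- m2) :> R by exact: expR_gt0.
have H_ge0 : 0 <= H.
  by rewrite -lee_fin; apply: le_trans hH; apply: integral_ge0 => x _; exact: nh.2.
pose G := z * (expR (- m1) * expR (- m2)) + expR (- m1) * H.
have G0 : 0 < G by rewrite ltr_pwDl// ?mulr_gt0// mulr_ge0// ltW.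
pose K := (expR (- m1) * expR (- m2)) * (expR (- m1) * expR (- m2)).
have K0 : 0 < K by rewrite !mulr_gt0.
pose a n := fine (pinZ e1 h z n 0 0); pose b n := fine (pinZ e1 h 0 n 0 0).
have Z0 w n : 0 <= w -> (0 <= pinZ e1 h w n 0 0)%E.
  by move=> w0; exact: (nnm_pinZ me e_gt0 mh h0 n w0).2 (0, 0).
have aub' n : (pinZ e1 h z n 0 0 <= (K * G ^+ n)%:E)%E.
  exact: (pinZ_ub me e_gt0 eC1 mh h0 hCh hH epsg n 0 0).
have aE n : pinZ e1 h z n 0 0 = (a n)%:E.
  by rewrite fineK// ge0_fin_numE ?Z0//; exact: le_lt_trans (aub' n) (ltry _).
have bE n : pinZ e1 h 0 n 0 0 = (b n)%:E.
  by rewrite fineK// ge0_fin_numE ?Z0//; exact: le_lt_trans (bub n) (ltry _).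
have [|||||||F F0 Flim] := @localization R a b (z ^+ 2) l C k K G n1
  (exprn_gt0 2 eps_pos) l0 C0 k0 K0 G0.
- by move=> n; rewrite -lee_fin -bE Z0.
- by move=> n; rewrite -lee_fin -bE -aE; exact: (pinZ_mono me e_gt0 mh h0 epsg n 0 0).
- by move=> n; rewrite -lee_fin -bE.
- by move=> n nn; rewrite -lee_fin -bE; exact: blb.
- by move=> n; rewrite -lee_fin -aE.
- move=> n m; rewrite -lee_fin EFinM (EFinM (a n)) -!aE.
  exact: (pinZ_superadditive me e_gt0 eC1 mh h0 hCh hH epsg n m 0 0).
- move=> n; rewrite -lee_fin -aE; apply: le_trans (pinZ_renewal me e_gt0 mh h0 epsg n 0 0).
  rewrite mulr_sumr -sumEFin; apply: lee_sum => i _.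
  by rewrite bE aE -!EFinM.
exists F => //; apply: cvg_trans Flim; apply: near_eq_cvg; near=> n.
have n0 : (0 < n)%N by near: n; exists 1%N.
by rewrite /free_energy_seq !partitionE.
Unshelve. all: end_near. Qed.
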